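(* Let $R\subseteq S_1$ and $R\subseteq S_2$ be ring extensions having FIP. For $i=1,2$ let $\Sigma_i$ be the seminormalization of $R$ in $S_i$, let $\mathcal R:=S_1\times S_2$, and regard $R\subseteq\mathcal R$ as a ring extension via the diagonal map. Then $R\subseteq\mathcal R$ has FIP if and only if all of the following hold: (i) $R$ has only finitely many ideals; (ii) $\mathrm{Supp}_R(\Sigma_1/R)\cap\mathrm{Supp}_R(\Sigma_2/R)\cap\Sigma\mathrm{Max}(R)=\emptyset$; (iii) for each $i\in\{1,2\}$ and each $M\in\mathrm{Supp}_R(\Sigma_i/R)\cap\Sigma\mathrm{Max}(R)$, either $R_M\subset(\Sigma_i)_M$ is a special minimal ramified extension or $R_M$ is a field.
   Context: All rings are commutative, unital and nonzero; ring morphisms are unital. For a ring extension $R\subseteq S$, $[R,S]$ is the set of all $R$-subalgebras of $S$; the extension has FIP if $[R,S]$ is finite, and it is minimal if $R\neq S$ and $[R,S]=\{R,S\}$. The conductor is $(R:S)=\{x\in R\mid xS\subseteq R\}$. For an $R$-module $E$, $\mathrm{Supp}_R(E)=\{P\in\mathrm{Spec}(R)\mid E_P\neq0\}$, and for $P\in\mathrm{Spec}(R)$, $S_P$ means $S_{R\setminus P}$. $R\subseteq S$ is seminormal if $b\in S$ and $b^2,b^3\in R$ imply $b\in R$. The seminormalization of $R$ in $S$ is the smallest $B\in[R,S]$ such that $B\subseteq S$ is seminormal. An FMIR is a ring with only finitely many ideals. $\Sigma\mathrm{Max}(R)$ is the set of all $M\in\mathrm{Max}(R)$ such that $R_M$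 is an infinite FMIR. A minimal ramified extension $R\subset T$ is a minimal, module-finite extension such that $M:=(R:T)$ is a maximal ideal of $R$ and there is $M'\in\mathrm{Max}(T)$ with $M'^2\subseteq M\subset M'$, $[T/M:R/M]=2$ and $R/M\to T/M'$ an isomorphism. A minimal ramified extension $(R,M)\hookrightarrow(S,N)$ between quasi-local rings (rings with a unique maximal ideal, here $M$ and $N$ respectively) is called special if $M^2=MN=0$ and $N^2=M$. *)

(* Defs.v *)
From HB Require Import structures.
From mathcomp Require Import all_boot all_order all_algebra.
From mathcomp Require Import generic_quotient ring_quotient.
From mathcomp Require Import boolp classical_sets functions cardinality.
From mathcomp Require Import ring.

Set Implicit Arguments.
Unset Strict Implicit.
Unset Printing Implicit Defensive.

Import GRing.Theory.

Local Open Scope ring_scope.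
Local Open Scope quotient_scope.
Local Open Scope classical_set_scope.

(* Conventions:
   - Subsets of rings that carry algebraic closure properties are boolean
     predicates {pred A}, as in ssralg; since excluded middle is available, every
     subset has this form.
   - A ring extension is an injective {rmorphism A -> B}.  An R-algebra S is
     viewed as the morphism in_alg S : R -> S.
   - Localizations and quotients live in comPzRingType because the
     localization of an arbitrary algebra may be the zero ring.
   - Spec R is the type prime_idealr R. *)

Section Ideals.
Variable A : comPzRingType.

Definition is_ideal (I : {pred A}) : Prop :=
  GRing.submod_closed (I : {pred A^o}).

Definition maximal_ideal (M : {pred A}) : Prop :=
  [/\ is_ideal M, 1 \notin M &
      forall J : {pred A}, is_ideal J -> {subset M <= J} ->
        J =i M \/ J =i predT].

Definition finitely_many_ideals : Prop :=
  finite_set [set I : A -> bool | is_ideal I].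

Definition quasi_local_with (M : {pred A}) : Prop :=
  forall J : {pred A}, maximal_ideal J <-> J =i M.

Definition is_field : Prop :=
  (1 : A) != 0 /\ forall x : A, x != 0 -> exists y, x * y = 1.

(* The set of finite sums of products; when I and J are ideals this is the
   product ideal IJ. *)
Definition sum_products (I J : {pred A}) : {pred A} := fun x =>
  `[< exists n (a b : 'I_n -> A),
        (forall i, a i \in I /\ b i \in J) /\ x = \sum_(i < n) a i * b i >].

End Ideals.

Section ModuleQuotient.
Variables (R : pzRingType) (E : lmodType R) (N : submodClosed E).

Definition submod_pred : {pred E} := fun x => x \in N.

Fact submod_pred_zmod_closed : zmod_closed submod_pred.
Proof.
split=> [|x y xN yN]; first exact: (rpred0 N).
by rewrite /submod_pred unfold_in -scaleN1r rpredD ?rpredZ.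
Qed.
HB.instance Definition _ :=
  GRing.isZmodClosed.Build E submod_pred submod_pred_zmod_closed.

Definition modquot := Quotient.quot submod_pred.
HB.instance Definition _ := GRing.Zmodule.on modquot.

Definition modquot_pi (x : E) : modquot := \pi_(Quotient.quot submod_pred) x.

Lemma modquot_eq x y : (modquot_pi x == modquot_pi y) = (x - y \in N).
Proof. by rewrite /modquot_pi -Quotient.idealrBE. Qed.

Lemma modquot_ind (T : modquot -> Prop) :
  (forall x, T (modquot_pi x)) -> forall q, T q.
Proof. by move=> Tpi q; rewrite -[q]reprK; apply: Tpi. Qed.

Lemma modquot_piD x y : modquot_pi (x + y) = modquot_pi x + modquot_pi y.
Proof. by rewrite /modquot_pi raddfD. Qed.

Lemma modquot_repr x : repr (modquot_pi x) - x \in N.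
Proof. by rewrite -modquot_eq /modquot_pi reprK. Qed.

Definition modquot_scale (a : R) (q : modquot) : modquot :=
  modquot_pi (a *: repr q).

Lemma modquot_scaleE a x :
  modquot_scale a (modquot_pi x) = modquot_pi (a *: x).
Proof. by apply/eqP; rewrite modquot_eq -scalerBr rpredZ ?modquot_repr. Qed.

Fact modquot_scalerA a b q :
  modquot_scale a (modquot_scale b q) = modquot_scale (a * b) q.
Proof. by elim/modquot_ind: q => x; rewrite !modquot_scaleE scalerA. Qed.
Fact modquot_scale1r : left_id 1 modquot_scale.
Proof. by elim/modquot_ind=> x; rewrite modquot_scaleE scale1r. Qed.
Fact modquot_scalerDr : right_distributive modquot_scale +%R.
Proof.
move=> a p q; elim/modquot_ind: p => x; elim/modquot_ind: q => y.
by rewrite -modquot_piD !modquot_scaleE scalerDr modquot_piD.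
Qed.
Fact modquot_scalerDl q :
  {morph modquot_scale^~ q : a b / a + b}.
Proof.
move=> a b; elim/modquot_ind: q => x.
by rewrite !modquot_scaleE scalerDl modquot_piD.
Qed.
HB.instance Definition _ := GRing.Zmodule_isLmodule.Build R modquot
  modquot_scalerA modquot_scale1r modquot_scalerDr modquot_scalerDl.

End ModuleQuotient.

(* An ideal is a submodule of the regular module A^o. *)
Section IdealQuotient.
Variables (A : comPzRingType) (I : submodClosed A^o).

Definition ringquot : Type := modquot I.
HB.instance Definition _ := GRing.Zmodule.on ringquot.

Definition ringquot_pi (x : A) : ringquot := modquot_pi I (x : A^o).

Definition ringquot_mul (p q : ringquot) : ringquot :=
  ringquot_pi ((repr p : A) * (repr q : A)).

Lemma ringquot_mulE x y :
  ringquot_mul (ringquot_pi x) (ringquot_pi y) = ringquot_pi (x * y).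
Proof.
apply/eqP; rewrite modquot_eq.
set x' := repr _; set y' := repr _.
have -> : (x' : A) * y' - x * y = (y' : A) * (x' - x) + x * (y' - y) :> A.
  by rewrite !mulrBr addrA ![y' * _]mulrC subrK.
by apply: (@rpredD _ I); apply: (@rpredZ _ _ I); apply: modquot_repr.
Qed.

Fact ringquot_mulA : associative ringquot_mul.
Proof.
elim/modquot_ind=> x; elim/modquot_ind=> y; elim/modquot_ind=> z.
by rewrite -![modquot_pi _ _]/(ringquot_pi _) !ringquot_mulE mulrA.
Qed.
Fact ringquot_mulC : commutative ringquot_mul.
Proof. by move=> x y; rewrite /ringquot_mul mulrC. Qed.
Fact ringquot_mul1 : left_id (ringquot_pi 1) ringquot_mul.
Proof.
elim/modquot_ind=> x.
by rewrite -[modquot_pi _ _]/(ringquot_pi _) ringquot_mulE mul1r.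
Qed.
Fact ringquot_mulDl : left_distributive ringquot_mul +%R.
Proof.
elim/modquot_ind=> x; elim/modquot_ind=> y; elim/modquot_ind=> z.
rewrite -modquot_piD -![modquot_pi _ _]/(ringquot_pi _) !ringquot_mulE mulrDl.
exact: modquot_piD.
Qed.
HB.instance Definition _ := GRing.Zmodule_isComPzRing.Build ringquot
  ringquot_mulA ringquot_mulC ringquot_mul1 ringquot_mulDl.

End IdealQuotient.

(* The map A / I -> B / J induced by f; it is the usual one as soon as
   f maps I into J, see ringquot_mapE. *)
Definition ringquot_map (A B : comPzRingType) (f : {rmorphism A -> B})
    (I : submodClosed A^o) (J : submodClosed B^o) (q : ringquot I) :
  ringquot J := ringquot_pi J (f (repr q)).

Arguments ringquot_map {A B} f I J q.

Lemma ringquot_mapE (A B : comPzRingType) (f : {rmorphism A -> B})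
    (I : submodClosed A^o) (J : submodClosed B^o) :
  (forall x, x \in I -> f x \in J) ->
  forall x, ringquot_map f I J (ringquot_pi I x) = ringquot_pi J (f x).
Proof.
move=> fIJ x; apply/eqP; rewrite modquot_eq.
by rewrite -[X in X \in _](rmorphB f) fIJ // modquot_repr.
Qed.

Section Localization.
Variables (R : comNzRingType) (P : prime_idealr R).

Record denominator := Denominator { den : R; denP : den \notin P }.
HB.instance Definition _ := [isSub for den].
HB.instance Definition _ := [Choice of denominator by <:].

Fact denominator_one : (1 : R) \notin P.
Proof. by rewrite idealr1. Qed.
Fact denominator_mul (s t : denominator) : den s * den t \notin P.
Proof. by rewrite prime_idealrM negb_or !denP. Qed.

Definition den1 : denominator := Denominator denominator_one.
Definition denM (s t : denominator) : denominator :=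
  Denominator (denominator_mul s t).

Section ModuleLocalization.
Variable E : lmodType R.

Definition loc_rel (p q : E * denominator) : bool :=
  `[< exists u : denominator,
        den u *: (den q.2 *: p.1) = den u *: (den p.2 *: q.1) >].

Fact loc_rel_equiv : equiv_class_of loc_rel.
Proof.
split=> [p|p q|q p r].
- by apply/asboolP; exists den1.
- by apply/asboolP/asboolP=> -[u pq]; exists u.
- move=> /asboolP[u pq] /asboolP[v qr]; apply/asboolP.
  exists (denM (denM u v) q.2) => /=.
  transitivity ((den v * den r.2) *: (den u *: (den q.2 *: p.1))).
    by rewrite !scalerA; congr (_ *: _); ring.
  rewrite pq.
  transitivity ((den u * den p.2) *: (den v *: (den r.2 *: q.1))).
    by rewrite !scalerA; congr (_ *: _); ring.
  by rewrite qr !scalerA; congr (_ *: _); ring.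
Qed.
Canonical loc_rel_equivRel := EquivRelPack loc_rel_equiv.
Canonical loc_rel_encModRel := defaultEncModRel loc_rel.

(* The localization E_P. *)
Definition loc := {eq_quot loc_rel}.
HB.instance Definition _ : EqQuotient _ loc_rel loc := EqQuotient.on loc.
HB.instance Definition _ := Choice.on loc.

Definition frac (x : E) (s : denominator) : loc := \pi_loc (x, s).

Lemma frac_eq x s y t :
  frac x s = frac y t <->
  exists u : denominator, den u *: (den t *: x) = den u *: (den s *: y).
Proof.
split=> [/eqP|H]; first by rewrite /frac piE => /asboolP.
by apply/eqP; rewrite /frac piE; apply/asboolP.
Qed.

Lemma frac_eqW x s y t : den t *: x = den s *: y -> frac x s = frac y t.
Proof. by move=> xy; apply/frac_eq; exists den1; rewrite xy. Qed.

Lemma loc_ind (T : loc -> Prop) : (forall x s, T (frac x s)) -> forall p, T p.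
Proof. by move=> Tf p; rewrite -[p]reprK; case: (repr p). Qed.

Lemma frac_repr x s : exists u : denominator,
  den u *: (den s *: (repr (frac x s)).1) =
  den u *: (den (repr (frac x s)).2 *: x).
Proof. by apply/frac_eq; rewrite /frac -surjective_pairing reprK. Qed.

Definition loc_add (p q : loc) : loc :=
  frac (den (repr q).2 *: (repr p).1 + den (repr p).2 *: (repr q).1)
       (denM (repr p).2 (repr q).2).
Definition loc_opp (p : loc) : loc := frac (- (repr p).1) (repr p).2.
Definition loc_scale (a : R) (p : loc) : loc :=
  frac (a *: (repr p).1) (repr p).2.

Lemma loc_addE x s y t :
  loc_add (frac x s) (frac y t) = frac (den t *: x + den s *: y) (denM s t).
Proof.
have [u xs] := frac_repr x s; have [v yt] := frac_repr y t.
rewrite /loc_add.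
move: (repr (frac x s)) (repr (frac y t)) xs yt => [x' s'] [y' t'] /= xs yt.
apply/frac_eq; exists (denM u v) => /=.
rewrite !scalerDr; congr (_ + _).
  transitivity ((den v * den t * den t') *: (den u *: (den s *: x'))).
    by rewrite !scalerA; congr (_ *: _); ring.
  by rewrite xs !scalerA; congr (_ *: _); ring.
transitivity ((den u * den s * den s') *: (den v *: (den t *: y'))).
  by rewrite !scalerA; congr (_ *: _); ring.
by rewrite yt !scalerA; congr (_ *: _); ring.
Qed.

Lemma loc_oppE x s : loc_opp (frac x s) = frac (- x) s.
Proof.
have [u xs] := frac_repr x s.
by apply/frac_eq; exists u; rewrite !scalerN xs.
Qed.

Lemma loc_scaleE a x s : loc_scale a (frac x s) = frac (a *: x) s.
Proof.
rewrite /loc_scale; have [u xs] := frac_repr x s.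
move: (repr _) xs => [x' s'] /= xs.
apply/frac_eq; exists u => /=.
transitivity (a *: (den u *: (den s *: x'))).
  by rewrite !scalerA; congr (_ *: _); ring.
by rewrite xs !scalerA; congr (_ *: _); ring.
Qed.

Fact loc_addA : associative loc_add.
Proof.
elim/loc_ind=> x s; elim/loc_ind=> y t; elim/loc_ind=> z r.
rewrite !loc_addE; apply: frac_eqW => /=.
by rewrite !scalerDr !scalerA !addrA; do ![congr (_ + _)];
  congr (_ *: _); ring.
Qed.
Fact loc_addC : commutative loc_add.
Proof.
elim/loc_ind=> x s; elim/loc_ind=> y t.
rewrite !loc_addE; apply: frac_eqW => /=.
by rewrite !scalerDr !scalerA addrC; congr (_ + _); congr (_ *: _); ring.
Qed.
Fact loc_add0 : left_id (frac 0 den1) loc_add.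
Proof.
elim/loc_ind=> x s; rewrite !loc_addE; apply: frac_eqW => /=.
by rewrite scaler0 add0r !scalerA; congr (_ *: _); ring.
Qed.
Fact loc_addN : left_inverse (frac 0 den1) loc_opp loc_add.
Proof.
elim/loc_ind=> x s; rewrite loc_oppE !loc_addE; apply: frac_eqW => /=.
by rewrite scalerN addNr !scaler0.
Qed.
HB.instance Definition _ := GRing.isZmodule.Build loc
  loc_addA loc_addC loc_add0 loc_addN.

Lemma frac_add x s y t :
  frac x s + frac y t = frac (den t *: x + den s *: y) (denM s t).
Proof. exact: loc_addE. Qed.

Lemma frac_opp x s : - frac x s = frac (- x) s.
Proof. exact: loc_oppE. Qed.

Fact loc_scalerA a b p : loc_scale a (loc_scale b p) = loc_scale (a * b) p.
Proof. by elim/loc_ind: p => x s; rewrite !loc_scaleE scalerA. Qed.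
Fact loc_scale1r : left_id 1 loc_scale.
Proof. by elim/loc_ind=> x s; rewrite loc_scaleE scale1r. Qed.
Fact loc_scalerDr : right_distributive loc_scale +%R.
Proof.
move=> a; elim/loc_ind=> x s; elim/loc_ind=> y t.
rewrite frac_add !loc_scaleE frac_add; apply: frac_eqW => /=.
by rewrite !scalerDr !scalerA; congr (_ + _); congr (_ *: _); ring.
Qed.
Fact loc_scalerDl p : {morph loc_scale^~ p : a b / a + b}.
Proof.
elim/loc_ind: p => x s a b.
rewrite !loc_scaleE frac_add; apply: frac_eqW => /=.
by rewrite !scalerDr !scalerA -!scalerDl; congr (_ *: _); ring.
Qed.
HB.instance Definition _ := GRing.Zmodule_isLmodule.Build R loc
  loc_scalerA loc_scale1r loc_scalerDr loc_scalerDl.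

End ModuleLocalization.

Section AlgebraLocalization.
Variable A : comAlgType R.

Definition loc_alg : Type := loc A.
HB.instance Definition _ := GRing.Lmodule.on loc_alg.

Definition loc_mul (p q : loc_alg) : loc_alg :=
  frac ((repr p).1 * (repr q).1) (denM (repr p).2 (repr q).2).

Lemma loc_mulE (x : A) s (y : A) t :
  loc_mul (frac x s) (frac y t) = frac (x * y) (denM s t).
Proof.
have [u xs] := frac_repr x s; have [v yt] := frac_repr y t.
rewrite /loc_mul.
move: (repr (frac x s)) (repr (frac y t)) xs yt => [x' s'] [y' t'] /= xs yt.
apply/frac_eq; exists (denM u v) => /=.
transitivity ((den u *: (den s *: x')) * (den v *: (den t *: y'))).
  by rewrite -!scalerAl -!scalerAr !scalerA; congr (_ *: _); ring.
rewrite xs yt.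
by rewrite -!scalerAl -!scalerAr !scalerA; congr (_ *: _); ring.
Qed.

Fact loc_mulA : associative loc_mul.
Proof.
elim/loc_ind=> x s; elim/loc_ind=> y t; elim/loc_ind=> z r.
rewrite !loc_mulE; apply: frac_eqW => /=.
by rewrite mulrA; congr (_ *: _); ring.
Qed.
Fact loc_mulC : commutative loc_mul.
Proof.
elim/loc_ind=> x s; elim/loc_ind=> y t.
rewrite !loc_mulE; apply: frac_eqW => /=.
by rewrite mulrC; congr (_ *: _); ring.
Qed.
Fact loc_mul1 : left_id (frac (1 : A) den1) loc_mul.
Proof.
elim/loc_ind=> x s; rewrite loc_mulE; apply: frac_eqW => /=.
by rewrite mul1r; congr (_ *: _); ring.
Qed.
Fact loc_mulDl : left_distributive loc_mul +%R.
Proof.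
elim/loc_ind=> x s; elim/loc_ind=> y t; elim/loc_ind=> z r.
rewrite [X in loc_mul X _]frac_add !loc_mulE [RHS]frac_add.
apply: frac_eqW => /=.
rewrite mulrDl !scalerDr -!scalerAl !scalerA.
by congr (_ + _); congr (_ *: _); ring.
Qed.
HB.instance Definition _ := GRing.Zmodule_isComPzRing.Build loc_alg
  loc_mulA loc_mulC loc_mul1 loc_mulDl.

Lemma frac_mul (x : A) s (y : A) t :
  (frac x s : loc_alg) * (frac y t : loc_alg) = frac (x * y) (denM s t).
Proof. exact: loc_mulE. Qed.

End AlgebraLocalization.

Section LocalizedStructureMap.
Variable A : comAlgType R.

(* The canonical map R_P -> A_P. *)
Definition loc_in_alg (p : loc_alg R^o) : loc_alg A :=
  frac ((repr p).1 : R)%:A (repr p).2.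

Lemma loc_in_algE (a : R) s : loc_in_alg (frac (a : R^o) s) = frac a%:A s.
Proof.
have [u as_] := frac_repr (a : R^o) s.
rewrite /loc_in_alg; move: (repr _) as_ => [a' s'] /= as_.
apply/frac_eq; exists u => /=.
by have := congr1 (fun r : R => r%:A : A) as_; rewrite !scalerA.
Qed.

Fact loc_in_alg_zmod : zmod_morphism loc_in_alg.
Proof.
elim/loc_ind=> x s; elim/loc_ind=> y t.
rewrite frac_opp frac_add 3!loc_in_algE frac_opp frac_add; congr frac.
by rewrite scalerDl !scalerN scaleNr !scalerA.
Qed.
Fact loc_in_alg_monoid : monoid_morphism loc_in_alg.
Proof.
split; first by rewrite -[1]/(frac (1 : R^o) den1) loc_in_algE scale1r.
elim/loc_ind=> x s; elim/loc_ind=> y t.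
rewrite frac_mul !loc_in_algE frac_mul; congr frac.
by rewrite -scalerAl -scalerAr mulr1 scalerA.
Qed.
HB.instance Definition _ :=
  GRing.isZmodMorphism.Build _ _ loc_in_alg loc_in_alg_zmod.
HB.instance Definition _ :=
  GRing.isMonoidMorphism.Build _ _ loc_in_alg loc_in_alg_monoid.

End LocalizedStructureMap.
End Localization.

Arguments loc_in_alg {R} P A p.

Section RingExtensions.
Variables (A B : comPzRingType) (f : {rmorphism A -> B}).

Definition img (M : {pred A}) : {pred B} :=
  fun y => `[< exists2 x, x \in M & y = f x >].

(* [A, B], the set of A-subalgebras of B. *)
Definition intermediate : set (B -> bool) := [set C : B -> bool |
  [/\ 1 \in C, forall a, {in C &, forall x y, f a * x + y \in C}
    & {in C &, forall x y, x * y \in C}]].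

Definition FIP : Prop := finite_set intermediate.

Definition minimal_extension : Prop :=
  [/\ injective f, ~ (img predT =i predT)
    & forall C, intermediate C <-> (C =i img predT \/ C =i predT)].

Definition module_finite : Prop :=
  exists n (b : 'I_n -> B), forall y, exists a : 'I_n -> A,
    y = \sum_(i < n) f (a i) * b i.

(* The conductor (A : B), as an ideal of A. *)
Definition conductor : {pred A} :=
  fun x => `[< forall y, exists z, f x * y = f z >].

Fact conductor_submod : GRing.submod_closed (conductor : {pred A^o}).
Proof.
split; first by apply/asboolP=> y; exists 0; rewrite !raddf0 mul0r.
move=> a x x' /asboolP xc /asboolP xc'; apply/asboolP=> y.
have [z xz] := xc y; have [z' xz'] := xc' y.
exists (a * z + z'); rewrite [a *: x]/(a * x) !rmorphD !rmorphM.
by rewrite mulrDl -mulrA xz xz'.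
Qed.
HB.instance Definition _ := GRing.isSubmodClosed.Build A A^o
  (conductor : A^o -> bool) (GRing.submod_closed_semi conductor_submod).

(* The same set viewed inside B, where it is also an ideal. *)
Definition conductor_image : {pred B} := img conductor.

Fact conductor_image_submod :
  GRing.submod_closed (conductor_image : {pred B^o}).
Proof.
split.
  apply/asboolP; exists 0; last by rewrite raddf0.
  by case: conductor_submod.
move=> b _ _ /asboolP[x xc ->] /asboolP[x' xc' ->]; apply/asboolP.
have [z bz] := asboolP _ xc b.
exists (1 * z + x'); last by rewrite mul1r rmorphD -bz mulrC.
have zc : z \in conductor.
  apply/asboolP => y; have [w xw] := asboolP _ xc (b * y).
  by exists w; rewrite -bz -mulrA.
by case: conductor_submod => _ /(_ 1 z x' zc xc').
Qed.
HB.instance Definition _ := GRing.isSubmodClosed.Build B B^o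
  (conductor_image : B^o -> bool)
  (GRing.submod_closed_semi conductor_image_submod).

End RingExtensions.

(* B is free over A with a basis of n elements; when A is a field this says
   [B : A] = n. *)
Definition has_rank (A B : comPzRingType) (f : A -> B) (n : nat) : Prop :=
  exists b : 'I_n -> B,
    bijective (fun a : {ffun 'I_n -> A} => \sum_(i < n) f (a i) * b i).

Definition minimal_ramified (A B : comPzRingType) (f : {rmorphism A -> B}) :
    Prop :=
  let M : submodClosed A^o := conductor f in
  let MB : submodClosed B^o := conductor_image f in
  [/\ minimal_extension f, module_finite f, maximal_ideal (conductor f) &
   exists M' : submodClosed B^o,
     [/\ maximal_ideal (M' : {pred B}),
         {subset sum_products (M' : {pred B}) (M' : {pred B}) <= MB},
         {subset MB <= M'} /\ ~ (M' =i MB),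
         has_rank (ringquot_map f M MB) 2
       & bijective (ringquot_map f M M')]].

(* Special minimal ramified extensions (A, M) -> (B, N); ideals of A are
   multiplied with ideals of B through their images under f. *)
Definition special_minimal_ramified (A B : comPzRingType)
    (f : {rmorphism A -> B}) : Prop :=
  minimal_ramified f /\
  exists (M : {pred A}) (N : {pred B}),
    [/\ quasi_local_with M, quasi_local_with N,
        sum_products M M =i pred1 0,
        sum_products (img f M) N =i pred1 0
      & sum_products N N =i img f M].

Section Support.
Variable R : comNzRingType.

Definition Supp (E : lmodType R) (P : prime_idealr R) : Prop :=
  exists p : loc P E, p != 0.

Definition SigmaMax (M : prime_idealr R) : Prop :=
  [/\ maximal_ideal (M : {pred R}), infinite_set [set: loc_alg M R^o]
    & finitely_many_ideals (loc_alg M R^o)].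

Section BaseRing.
Variable A : comAlgType R.

(* The image of R in A, as an R-submodule. *)
Definition base_ring : {pred A} := fun x => `[< exists r : R, x = r%:A >].

Fact base_ring_submod : GRing.submod_closed base_ring.
Proof.
split=> [|a _ _ /asboolP[r ->] /asboolP[r' ->]]; apply/asboolP.
  by exists 0; rewrite scale0r.
by exists (a * r + r'); rewrite scalerDl scalerA.
Qed.
HB.instance Definition _ := GRing.isSubmodClosed.Build R A
  base_ring (GRing.submod_closed_semi base_ring_submod).

(* The R-module A / R. *)
Definition mod_base : lmodType R := modquot base_ring.

End BaseRing.

Section Subalgebra.
Variables (S : comAlgType R) (B : subalgClosed S).

Record subalg : Type := Subalg { subalg_val : S; _ : subalg_val \in B }.
HB.instance Definition _ := [isSub for subalg_val].
HB.instance Definition _ := [Choice of subalg by <:].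
HB.instance Definition _ := [SubChoice_isSubAlgebra of subalg by <:].
HB.instance Definition _ := [SubNzRing_isSubComNzRing of subalg by <:].

Definition seminormal : Prop :=
  forall b : S, b ^+ 2 \in B -> b ^+ 3 \in B -> b \in B.

End Subalgebra.

Definition is_seminormalization (S : comAlgType R) (B : subalgClosed S) :
    Prop :=
  seminormal B /\
  forall C : subalgClosed S, seminormal C -> {subset B <= C}.

Lemma seminormalization_exists (S : comAlgType R) :
  exists B : subalgClosed S, is_seminormalization B.
Proof.
pose D : {pred S} := fun b =>
  `[< forall C : subalgClosed S, seminormal C -> b \in C >].
have DP b : reflect (forall C : subalgClosed S, seminormal C -> b \in C)
    (b \in D) by exact: asboolP.
have Dalg : GRing.subalg_closed D.
  split; first by apply/DP=> C _; apply: rpred1.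
    move=> a x y /DP Dx /DP Dy; apply/DP=> C snC.
    by apply: rpredD; [apply/rpredZ/Dx | apply: Dy].
  move=> x y /DP Dx /DP Dy; apply/DP=> C snC.
  by apply: rpredM; [apply: Dx | apply: Dy].
pose m := GRing.isSubalgClosed.Build R S D (GRing.subalg_closed_semi Dalg).
pose B : subalgClosed S := HB.pack D m.
exists B; split.
  move=> b /DP b2 /DP b3; apply/DP=> C snC.
  by apply: (snC); [apply: b2 | apply: b3].
by move=> C snC b /DP; apply.
Qed.

Lemma intermediate_in_alg (S : comAlgType R) (C : S -> bool) :
  intermediate (in_alg S) C <-> GRing.subalg_closed (C : {pred S}).
Proof.
split=> -[C1 Clin Cmul]; split=> // a x y Cx Cy.
  by have := Clin a x y Cx Cy; rewrite /= mulr_algl.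
by rewrite /= mulr_algl; apply: Clin.
Qed.

(* The structure map of S1 * S2 is the diagonal map. *)
Lemma in_alg_prod (S1 S2 : comAlgType R) (r : R) :
  in_alg (S1 * S2)%type r = (in_alg S1 r, in_alg S2 r).
Proof. by []. Qed.

End Support.
Arguments subalg {R S} B.

(* Main.v *)
Require Import Defs.
From HB Require Import structures.
From mathcomp Require Import all_boot all_order all_algebra.
From mathcomp Require Import ring_quotient.
From mathcomp Require Import boolp classical_sets functions cardinality.
From mathcomp Require Import ring.

Set Implicit Arguments.
Unset Strict Implicit.
Unset Printing Implicit Defensive.

Import GRing.Theory.

Local Open Scope ring_scope.
Local Open Scope classical_set_scope.

(** Condition (i) follows from FIP by attaching to an ideal I of R the
    subalgebra of pairs (a, a + i) with i in I, and it makes R zero-dimensional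
    with finitely many idempotents.  Everything then splits along the primitive
    idempotents e of R: a prime ideal M is the set of a with e a nilpotent, the
    localization at M is multiplication by e, and the seminormalization of R in
    S is R + Nil(S), so that M supports it when e Nil(S) is not inside R.  If
    the local ring eR is infinite, then so is its residue field, and the maximal
    ideal of eR is generated by one element t.

    Necessity.  An infinite residue field turns a one-parameter family of
    subalgebras into an infinite set.  A nilpotent of eS outside R yields an x
    outside R such that x^2 and the products of x with nilpotents of R are in R
    ([almost_exists]).  Given such x in S1 and y in S2, the subalgebras
    generated by the pairs (x, r y) are pairwise distinct, hence (ii)
    ([not_both_almost_base]).  For a single x and t <> 0, gluing R + Rx to R
    along the ideals generated by x + r t and t^2 gives an infinite family
    unless x^2 = u t with u a unit, and this relation forces t^2 = t x = 0
    ([almost_special]).  Finally the algebras generated by x + r z exclude any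
    nilpotent z of eS1 outside R + Rx ([enil_span]).  These relations are what
    a special minimal ramified extension is made of
    ([special_minimal_ramified_intro]).

    Sufficiency.  If eR is finite, so is eS for every FIP extension S
    ([finite_fixed]).  Otherwise, up to exchanging S1 and S2, the nilpotents of
    eS2 are in R.  There are finitely many subalgebras D that contain
    0 * Nil(S2) ([finite_subal_over_nil]): D is determined by its two
    projections, by the largest idempotent g with (0, g) in D, and by one
    partner y in D of each x in a finite generating set of the first projection;
    up to nilpotents and to g, this y is a root of a polynomial that kills x,
    and there are finitely many roots.  The part e C of an arbitrary subalgebra
    C is determined by D = C + 0 * Nil(S2) and by the ideal of the r such that
    (e r, 0) is in C.  Indeed, by (ii) and (iii), either (n, 0) is in C for
    every e-nilpotent n of the first projection ([nil_absorbed]), or all these n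
    come from R ([nil_in_base]). *)

(** * Finite families and nilpotent elements *)

(** The datum related to x need not be a function of x, as long as it determines
    x; this allows choices such as a maximal idempotent in it. *)
Lemma finite_by_data (T U : Type) (A : set T) (B : set U) (rel : T -> U -> Prop) :
  finite_set B -> (forall x, A x -> exists2 b, B b & rel x b) ->
  (forall x y b, A x -> A y -> rel x b -> rel y b -> x = y) -> finite_set A.
Proof.
move=> finB ex inj.
have [[x0 Ax0]|A0] := pselect (exists x, A x); last first.
  suff -> : A = set0 by exact: finite_set0.
  by apply/seteqP; split=> // x Ax; apply: A0; exists x.
have [b0 _ _] := ex x0 Ax0.
have [g gP] : exists g : T -> U, forall x, A x -> B (g x) /\ rel x (g x).
  exists (fun x => if pselect (A x) is left Ax then projT1 (cid2 (ex x Ax)) else b0).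
  by move=> x Ax; case: pselect => // Ax'; case: (cid2 _).
apply: (@sub_finite_set _ _ ([set x | A x /\ B (g x)])) => [x Ax|].
  by split=> //; case: (gP x Ax).
pose f (x : T) : option U := if pselect (A x) is left _ then Some (g x) else None.
apply: (@sub_finite_set _ _ (f @^-1` (Some @` B))) => [x [Ax Bx]|].
  by rewrite /= /f; case: pselect => // _; exists (g x).
apply: finite_preimage; last exact: finite_image.
move=> x y /set_mem [b1 _ h1] /set_mem [b2 _ h2]; move: h1 h2; rewrite /f.
case: pselect => // Ax _; case: pselect => // Ay _ [gxy].
by apply: (inj _ _ (g x)) => //; [case: (gP x Ax) | rewrite gxy; case: (gP y Ay)].
Qed.

Lemma finite_powerset (T : Type) (A : set T) :
  finite_set A -> finite_set [set B : set T | B `<=` A].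
Proof.
move=> /(@finite_seqP {classic T} A) [s ->].
elim: s => [|a s IH].
  apply: (@sub_finite_set _ _ [set set0]); last exact: finite_set1.
  by move=> B /= sB; apply/seteqP; split=> // x /sB.
apply: (@sub_finite_set _ _ ([set B : set T | B `<=` [set` s]] `|`
   (fun B : set T => B `|` [set a]) @` [set B : set T | B `<=` [set` s]])); last first.
  by rewrite finite_setU; split=> //; apply: finite_image.
move=> B /= sB; have [Ba|nBa] := pselect (B a); last first.
  left=> x Bx /=; have /= := sB x Bx; rewrite inE => /orP[/eqP xa|//].
  by case: nBa; rewrite -xa.
right; exists (B `&` [set` s]) => [x []//|].
apply/seteqP; split=> x; first by case=> [[]//|->].
move=> Bx; have /= := sB x Bx; rewrite inE => /orP[/eqP ->|]; first by right.
by left.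
Qed.

Lemma chain_repeat (T : Type) (A : set T) (u : nat -> T) :
  finite_set A -> (forall n, A (u n)) -> exists i j, (i < j)%N /\ u i = u j.
Proof.
move=> finA Au; apply: contrapT => nE.
apply: infinite_nat; apply: (@sub_finite_set _ _ (u @^-1` A)) => [n _|]; first exact: Au.
apply: finite_preimage finA => i j _ _ uij.
by case: (ltngtP i j) => // lt; case: nE; [exists i, j|exists j, i].
Qed.

Lemma last_step (P : nat -> Prop) n : P 0%N -> ~ P n -> exists j, P j /\ ~ P j.+1.
Proof.
move=> P0; elim: n => [//|n IH] nP.
by have [Pn|/IH//] := pselect (P n); exists n.
Qed.

Section Nil.
Variable A : comPzRingType.
Implicit Types a f x y : A.

Definition nilpot x := exists n, x ^+ n = 0.

Lemma nil0 : nilpot 0.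
Proof. by exists 1%N; rewrite expr1. Qed.

Lemma nilMl y x : nilpot x -> nilpot (y * x).
Proof. by case=> n xn; exists n; rewrite exprMn xn mulr0. Qed.

Lemma nilMr y x : nilpot x -> nilpot (x * y).
Proof. by rewrite mulrC; apply: nilMl. Qed.

Lemma nilN x : nilpot x -> nilpot (- x).
Proof. by rewrite -mulN1r; apply: nilMl. Qed.

Lemma nilX k x : nilpot (x ^+ k) -> nilpot x.
Proof. by case=> m xm; exists (k * m)%N; rewrite exprM. Qed.

Lemma nilD x y : nilpot x -> nilpot y -> nilpot (x + y).
Proof.
case=> n xn [m ym]; exists (n + m)%N; rewrite exprDn big1 // => i _.
have [mi|im] := leqP m i.
  by rewrite -(subnK mi) exprD ym !mulr0 mul0rn.
have ni : (n <= n + m - i)%N by rewrite -addnBA ?leq_addr // ltnW.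
by rewrite -(subnK ni) exprD xn !(mulr0, mul0r) mul0rn.
Qed.

Lemma nilB x y : nilpot x -> nilpot y -> nilpot (x - y).
Proof. by move=> nx ny; apply: nilD => //; apply: nilN. Qed.

Lemma nil_sum (I : Type) (r : seq I) (P : pred I) (F : I -> A) :
  (forall i, P i -> nilpot (F i)) -> nilpot (\sum_(i <- r | P i) F i).
Proof. move=> nF; apply: big_ind => //; [exact: nil0|exact: nilD]. Qed.

Lemma idemX f k : f * f = f -> f ^+ k.+1 = f.
Proof. by move=> ff; elim: k => [|k IH]; rewrite ?expr1 // exprS IH. Qed.

Lemma nil_idem f : f * f = f -> nilpot f -> f = 0.
Proof. by move=> ff [[|n]]; rewrite ?idemX // expr0 => f0; rewrite -[f]mulr1 f0 mulr0. Qed.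

(** Iterating the equation multiplies [a] by ever higher powers of [n]. *)
Lemma nil_fix a (n : A) : nilpot n -> a = a * n -> a = 0.
Proof.
case=> k nk an; rewrite -(mulr0 a) -nk; elim: k {nk} => [|k IH]; first by rewrite expr0 mulr1.
by rewrite exprS mulrA -an.
Qed.

End Nil.

Lemma nil_morph (A B : comPzRingType) (f : {rmorphism A -> B}) x : nilpot x -> nilpot (f x).
Proof. by case=> n xn; exists n; rewrite -rmorphXn xn rmorph0. Qed.

Lemma nil_inj (A B : comPzRingType) (f : {rmorphism A -> B}) x :
  injective f -> nilpot (f x) -> nilpot x.
Proof. by move=> fI [n xn]; exists n; apply: fI; rewrite rmorphXn xn rmorph0. Qed.

(** * Idempotents *)
Lemma count_ltn (T : eqType) (P Q : pred T) (s : seq T) x :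
  subpred P Q -> x \in s -> ~~ P x -> Q x -> (count P s < count Q s)%N.
Proof.
move=> PQ + Px Qx; elim: s => //= y s IH; rewrite inE => /predU1P[<-|/IH lt].
  by rewrite (negPf Px) Qx add0n add1n ltnS sub_count.
by rewrite -addnS leq_add //; case: (P y) (PQ y) => [->|].
Qed.

Section Idempotents.
Variable A : comPzRingType.
Definition idem (f : A) := f * f = f.
Definition primitive (e : A) :=
  [/\ idem e, e <> 0 & forall f, idem f -> e * f = 0 \/ e * f = e].

Lemma idemM e f : idem e -> idem f -> idem (e * f).
Proof. by rewrite /idem => ee ff; rewrite mulrACA ee ff. Qed.

Lemma idemC e : idem e -> idem (1 - e).
Proof. by rewrite /idem => ee; rewrite mulrBl mul1r mulrBr ee mulr1 subrr subr0. Qed.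

Hypothesis fin : finite_set [set f | idem f].

(** An idempotent that is not primitive is a sum of two orthogonal ones with
    fewer idempotents below them. *)
Lemma idem_ind (P : A -> Prop) :
  P 0 -> (forall e f, idem e -> idem f -> e * f = 0 -> P e -> P f -> P (e + f)) ->
  (forall e, primitive e -> P e) -> forall e, idem e -> P e.
Proof.
move=> P0 PD Pp.
have [s sE] := (finite_seqP _).1 fin.
have sP f : idem f <-> f \in s.
  by rewrite -[idem f]/([set f | idem f] f) sE.
pose mu (e : A) := count (fun f => f * e == f) s.
have muS e f : idem e -> idem f -> e * f <> e -> (mu (e * f)%R < mu e)%N.
  move=> ide idf efe; apply: (@count_ltn _ _ _ _ e).
  - move=> g /eqP ge; apply/eqP; transitivity (g * (e * e * f)); [rewrite -{1}ge; ring|by rewrite ide].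
  - exact: (sP e).1.
  - by apply/eqP; rewrite mulrA ide.
  - exact/eqP.
move=> e; have [n] := ubnP (mu e); elim: n e => [|n IH] e; rewrite ?ltn0 ?ltnS => mue ide; first by [].
have [->//|e0] := pselect (e = 0).
have [/Pp//|np] := pselect (primitive e).
have [f [idf [ef0 efe]]] : exists f, idem f /\ e * f <> 0 /\ e * f <> e.
  apply: contrapT => nE; apply: np; split=> // f idf.
  have [|h0] := pselect (e * f = 0); first by left.
  by right; apply: contrapT => he; apply: nE; exists f.
have id1f := idemC idf.
have -> : e = e * f + e * (1 - f) by ring.
apply: PD; rewrite ?idemM //.
- by apply: idemM.
- by apply: idemM.
- by rewrite mulrACA mulrBr mulr1 idf subrr mulr0.
- apply: IH; last exact: idemM.
  by apply: leq_trans mue; apply: muS.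
- apply: IH; last exact: idemM.
  apply: leq_trans mue; apply: muS => //.
  rewrite mulrBr mulr1 => h; apply: ef0; have -> : e * f = e - (e - e * f) by ring.
  by rewrite h subrr.
Qed.

(** The join of two idempotents is f + g - f g, and [f * g = f] is the order. *)
Lemma idem_max (Q : A -> Prop) : Q 0 ->
  (forall f, Q f -> idem f) -> (forall f g, Q f -> Q g -> Q (f + g - f * g)) ->
  exists g, Q g /\ forall f, Q f -> f * g = f.
Proof.
move=> Q0 Qid QD.
have [s sE] := (finite_seqP _).1 fin.
have sP f : Q f -> f \in s.
  by move=> /Qid; rewrite -[idem f]/([set f | idem f] f) sE.
suff [g [Qg gP]] : exists g, Q g /\ forall f, f \in s -> Q f -> f * g = f.
  by exists g; split=> // f Qf; apply: gP => //; apply: sP.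
elim: (s) => [|f r [g [Qg gP]]]; first by exists 0.
have [Qf|nQf] := pselect (Q f); last first.
  by exists g; split=> // h; rewrite inE => /predU1P[->//|]; apply: gP.
exists (f + g - f * g); split; first exact: QD.
move=> h; rewrite inE => /predU1P[-> _|hr Qh]; first by have := Qid _ Qf; rewrite /idem => ff; ring: ff.
by have hg := gP _ hr Qh; ring: hg.
Qed.

End Idempotents.

(** * Intermediate rings *)
Section Subal.
Variables (R S : comNzRingType).

Definition subal (f : R -> S) (C : set S) : Prop :=
  [/\ forall r, C (f r), forall x y, C x -> C y -> C (x - y)
    & forall x y, C x -> C y -> C (x * y)].

Variable f : {rmorphism R -> S}.

Section Closure.
Variables (C : set S) (sC : subal f C).

Lemma subal_base r : C (f r). Proof. by case: sC. Qed.
Lemma subalB x y : C x -> C y -> C (x - y). Proof. by case: sC => _ /(_ x y). Qed.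
Lemma subalM x y : C x -> C y -> C (x * y). Proof. by case: sC => _ _ /(_ x y). Qed.
Lemma subal0 : C 0. Proof. by rewrite -(rmorph0 f); apply: subal_base. Qed.
Lemma subal1 : C 1. Proof. by rewrite -(rmorph1 f); apply: subal_base. Qed.
Lemma subalN x : C x -> C (- x).
Proof. by move=> Cx; rewrite -sub0r; apply: subalB => //; apply: subal0. Qed.
Lemma subalD x y : C x -> C y -> C (x + y).
Proof. by move=> Cx Cy; rewrite -[y]opprK; apply: subalB => //; apply: subalN. Qed.
Lemma subalX x n : C x -> C (x ^+ n).
Proof.
by move=> Cx; elim: n => [|n IH]; [apply: subal1|rewrite exprS; apply: subalM].
Qed.
End Closure.

Lemma subal_base_ring : subal f (range f).
Proof.
split; first by move=> r; exists r.
  by move=> _ _ [a _ <-] [b _ <-]; exists (a - b); rewrite // rmorphB.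
by move=> _ _ [a _ <-] [b _ <-]; exists (a * b); rewrite // rmorphM.
Qed.

Lemma FIP_subal : FIP f <-> finite_set [set C | subal f C].
Proof.
split=> fin.
  apply: (sub_finite_set _ (finite_image (fun C : S -> bool => [set x | C x]) fin)).
  move=> C sC; exists (fun x => `[< C x >]); last first.
    by apply/seteqP; split=> x /= /asboolP.
  split; first by apply/asboolP; apply: (subal1 sC).
    move=> a x y /asboolP Cx /asboolP Cy; apply/asboolP.
    by apply: (subalD sC) => //; apply: (subalM sC) => //; apply: subal_base.
  by move=> x y /asboolP Cx /asboolP Cy; apply/asboolP; apply: (subalM sC).
apply: (sub_finite_set _ (finite_image (fun C : set S => (fun x => `[< C x >])) fin)).
move=> C [C1 CD CM]; exists [set x | C x]; last first.
  by apply/funext => x; apply/asboolP/idP.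
have C0 : C 0 by have := CD (-1) 1 1 C1 C1; rewrite rmorphN1 mulN1r addNr.
split=> /=.
- by move=> r; have := CD r 1 0 C1 C0; rewrite mulr1 addr0.
- by move=> x y Cx Cy; have := CD (-1) y x Cy Cx; rewrite rmorphN1 mulN1r addrC.
- exact: CM.
Qed.

Definition ev (p : {poly R}) (a : S) : S := (map_poly f p).[a].

Lemma evD p q a : ev (p + q) a = ev p a + ev q a.
Proof. by rewrite /ev rmorphD hornerD. Qed.
Lemma evB p q a : ev (p - q) a = ev p a - ev q a.
Proof. by rewrite /ev rmorphB hornerD hornerN. Qed.
Lemma evM p q a : ev (p * q) a = ev p a * ev q a.
Proof. by rewrite /ev rmorphM hornerM. Qed.
Lemma evC c a : ev c%:P a = f c.
Proof. by rewrite /ev map_polyC hornerC. Qed.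
Lemma ev1 a : ev 1 a = 1.
Proof. by rewrite -polyC1 evC rmorph1. Qed.
Lemma evX a : ev 'X a = a.
Proof. by rewrite /ev map_polyX hornerX. Qed.
Lemma evexp p n a : ev (p ^+ n) a = ev p a ^+ n.
Proof. by rewrite /ev rmorphXn horner_exp. Qed.
Lemma ev_sum p a : ev p a = \sum_(i < size p) f p`_i * a ^+ i.
Proof.
rewrite /ev (@horner_coef_wide _ (size p)) ?size_poly //.
by apply: eq_bigr => i _; rewrite coef_map.
Qed.

Lemma subal_ev C p a : subal f C -> C a -> C (ev p a).
Proof.
move=> sC Ca; elim/poly_ind: p => [|p c IH].
  by rewrite /ev rmorph0 horner0; apply: subal0 sC.
rewrite evD evM evX evC; apply: (subalD sC); last exact: subal_base.
exact: (subalM sC).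
Qed.

(** A polynomial X^n q with q(0) = 1 serves two purposes: it yields Fitting
    decompositions, because q = 1 - X p, and it stays nonzero modulo every
    prime ideal, because it has a coefficient 1. *)
Definition algebraic (a : S) := exists n q, q.[0] = 1 /\ a ^+ n * ev q a = 0.

End Subal.

Section Fitting.
Variable A : comPzRingType.
(** The idempotent [a * b] cuts the ring into a part where [a] is invertible and
    a part where [a] is nilpotent. *)
Definition fitting (a b : A) := idem (a * b) /\ nilpot ((1 - a * b) * a).

Lemma fitting_of_relation (a z : A) n : a ^+ n * (1 - a * z) = 0 -> fitting a (a ^+ n * z ^+ n.+1).
Proof.
move=> /eqP; rewrite mulrBr mulr1 mulrA -exprSr subr_eq0 => /eqP anz.
have H k : a ^+ n = a ^+ (n + k) * z ^+ k.
  elim: k => [|k IH]; first by rewrite addn0 expr0 mulr1.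
  by rewrite {1}IH exprD {1}anz addnS !exprS exprD; ring.
have E : a * (a ^+ n * z ^+ n.+1) = (a * z) ^+ n.+1 by rewrite exprMn !exprS; ring.
have aN : a ^+ n.+1 = a ^+ n.+1 * (a * z) ^+ n.+1.
  by rewrite exprMn {1}exprS {1}(H n.+1) exprD !exprS; ring.
have id : idem ((a * z) ^+ n.+1).
  by rewrite /idem {1}exprMn mulrAC -aN -exprMn.
split; rewrite /idem E //.
by exists n.+1; rewrite exprMn (idemX _ (idemC id)) mulrBl mul1r mulrC -aN subrr.
Qed.
End Fitting.

(** * Rings with finitely many ideals *)
Section ZeroDim.
Variable R : comNzRingType.

Definition ideal_set (I : set R) := [/\ I 0, forall x y, I x -> I y -> I (x + y)
  & forall a x, I x -> I (a * x)].

Lemma finitely_many_ideal_sets : finitely_many_ideals R <-> finite_set [set I | ideal_set I].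
Proof.
split=> fin.
  apply: (sub_finite_set _ (finite_image (fun C : R -> bool => [set x | C x]) fin)).
  move=> I [I0 ID IM]; exists (fun x => `[< I x >]); last first.
    by apply/seteqP; split=> x /= /asboolP.
  split; first by apply/asboolP.
  by move=> a x y /asboolP Ix /asboolP Iy; apply/asboolP; apply: ID => //; apply: IM.
apply: (sub_finite_set _ (finite_image (fun C : set R => (fun x => `[< C x >])) fin)).
move=> I [I0 ID]; exists [set x | I x]; last first.
  by apply/funext => x; apply/asboolP/idP.
split=> //.
- by move=> x y Ix Iy; have := ID 1 x y Ix Iy; rewrite scale1r.
- by move=> a x Ix; have := ID a x 0 Ix I0; rewrite addr0.
Qed.

Definition principal (a : R) : set R := [set y | exists z, y = a * z].

Lemma ideal_set_principal a : ideal_set (principal a).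
Proof.
split; first by exists 0; rewrite mulr0.
  by move=> _ _ [x ->] [y ->]; exists (x + y); rewrite mulrDr.
by move=> b _ [x ->]; exists (b * x); rewrite mulrCA.
Qed.

Lemma principal_self a : principal a a.
Proof. by exists 1; rewrite mulr1. Qed.

Hypothesis fin : finite_set [set I : set R | ideal_set I].

Lemma fitting_base (a : R) : exists b, fitting a b.
Proof.
have [i [j [ij E]]] := chain_repeat fin (fun n => ideal_set_principal (a ^+ n)).
have [z az] : principal (a ^+ j) (a ^+ i) by rewrite -E; apply: principal_self.
exists (a ^+ i * (a ^+ (j - i).-1 * z) ^+ i.+1); apply: fitting_of_relation.
rewrite mulrBr mulr1 {1}az -{1}(subnKC ij) exprD exprS.
by rewrite -subnS; ring.
Qed.

(** An idempotent is determined by the ideal that it generates. *)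
Lemma finite_idem : finite_set [set f : R | idem f].
Proof.
apply: (finite_by_data (rel := fun f I => I = principal f) fin).
  by move=> f _; exists (principal f) => //; apply: ideal_set_principal.
move=> f g I ff gg -> E.
have [z fz] : principal g f by rewrite -E; apply: principal_self.
have [w gw] : principal f g by rewrite E; apply: principal_self.
transitivity (f * g); first by rewrite {2}fz -mulrA mulrCA gg mulrC -fz.
by rewrite {1}gw mulrA ff.
Qed.

Section OverR.
Variables (S : comNzRingType) (f : {rmorphism R -> S}).

Lemma fitting_subal C a : subal f C -> C a -> algebraic f a -> exists2 b, C b & fitting a b.
Proof.
move=> sC Ca [n [q [q0 aq]]].
have /factor_theorem [p pE] : root (1 - q) 0 by rewrite /root !hornerE q0 subrr.
have qE : ev f q a = 1 - a * ev f p a.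
  rewrite -[q](subKr 1) pE evB ev1 evM evB evX evC rmorph0 subr0; congr (_ - _).
  exact: mulrC.
exists (a ^+ n * ev f p a ^+ n.+1); last by apply: fitting_of_relation; rewrite -qE.
by apply: (subalM sC); apply: (subalX sC) => //; apply: subal_ev.
Qed.

Hypothesis finf : finite_set [set C | subal f C].

(** Two members of the descending chain R + a^(n+1) R[a] coincide, which gives
    f c = a^n q0(a) with q0(0) = 1; the Fitting relation of c in R then kills
    the constant c. *)
Lemma algebraic_FIP a : algebraic f a.
Proof.
pose u n : set S := [set y | exists c p, y = f c + a ^+ n.+1 * ev f p a].
have su n : subal f (u n).
  split.
  - by move=> r; exists r, 0; rewrite /ev rmorph0 horner0 mulr0 addr0.
  - move=> _ _ [c [p ->]] [d [q ->]]; exists (c - d), (p - q).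
    by rewrite rmorphB evB; ring.
  - move=> _ _ [c [p ->]] [d [q ->]].
    exists (c * d), (c%:P * q + d%:P * p + 'X^(n.+1) * p * q).
    by rewrite !evD !evM evexp evX !evC; ring.
have [i [j [ij E]]] := chain_repeat finf su.
have [c [p ap]] : u j (a ^+ i.+1).
  by rewrite -E; exists 0, 1; rewrite rmorph0 ev1 add0r mulr1.
have [q0 [q00 cE]] : exists q0, q0.[0] = 1 /\ f c = a ^+ i.+1 * ev f q0 a.
  exists (1 - 'X^(j - i) * p); split.
    by rewrite !hornerE expr0n subn_eq0 leqNgt ij /= mul0r subr0.
  rewrite evB ev1 evM evexp evX mulrBr mulr1 mulrA -exprD addSn subnKC ?(ltnW ij) //.
  by rewrite {1}ap addrK.
have [b [idc [k ck]]] := fitting_base c.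
exists (i.+1 * k)%N, (q0 ^+ k * (1 - b%:P * 'X^(i.+1) * q0)); split.
  rewrite hornerM horner_exp q00 expr1n mul1r hornerD hornerN hornerM q00 hornerM hornerXn expr0n.
  by rewrite hornerC /= mulr0 mul0r subr0.
have -> : ev f (q0 ^+ k * (1 - b%:P * 'X^(i.+1) * q0)) a = ev f q0 a ^+ k * (1 - f b * f c).
  by rewrite evM evexp evB ev1 -mulrA evM evC evM evexp evX -cE.
rewrite mulrA exprM -exprMn -cE -rmorphXn -rmorphM -(rmorph1 f) -rmorphB -rmorphM.
suff -> : c ^+ k * (1 - b * c) = 0 by rewrite rmorph0.
have id1 := idemC idc.
case: k ck => [|k]; last first.
  by rewrite exprMn (idemX _ id1) mulrC [b * c]mulrC.
by move/eqP; rewrite expr0 oner_eq0.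
Qed.

Lemma idem_lift a h : idem h -> idem (f a * h) -> exists2 c, idem c & f a * h = f c * h.
Proof.
move=> hh; set p := f a * h => pp.
have [b [idc nc]] := fitting_base a.
exists (a * b) => //.
have pc : p * (1 - f (a * b)) = 0.
  apply: nil_idem; first by apply: idemM => //; apply: idemC; rewrite /idem -rmorphM idc.
  rewrite (_ : p * _ = h * f ((1 - a * b) * a)); last by rewrite /p; ring.
  by apply: nilMl; apply: nil_morph.
have {pc} pc : p * f (a * b) = p by move/eqP: pc; rewrite mulrBr mulr1 subr_eq0 => /eqP.
have E : f (a * b) * h = f b * p by rewrite /p rmorphM; ring.
have hp : h * p = p by rewrite /p mulrCA hh.
by rewrite -{1}pc -{1}hp mulrAC [h * _]mulrC E -mulrA pp.
Qed.

(** g generates R + R g.  If h generates the same ring, its components along g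
    and 1 - g are multiples of these by elements of R, which can be chosen
    idempotent ([idem_lift]); so each such ring has finitely many idempotent
    generators. *)
Lemma finite_idem_FIP : finite_set [set g : S | idem g].
Proof.
pose gen g : set S := [set y | exists a b, y = f a + f b * g].
have sgen g : idem g -> subal f (gen g).
  move=> gg; split.
  - by move=> r; exists r, 0; rewrite rmorph0 mul0r addr0.
  - move=> _ _ [a [b ->]] [c [d ->]]; exists (a - c), (b - d).
    by rewrite !rmorphB; ring.
  - move=> _ _ [a [b ->]] [c [d ->]]; exists (a * c), (a * d + b * c + b * d).
    rewrite !rmorphD !rmorphM.
    transitivity (f a * f c + (f a * f d + f b * f c) * g + f b * f d * (g * g)); first by ring.
    by rewrite gg; ring.
apply: (@sub_finite_set _ _ (\bigcup_(B in [set C | subal f C]) [set g | idem g /\ gen g = B])).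
  by move=> g gg; exists (gen g) => //; apply: sgen.
apply: bigcup_finite => // B _.
have [[g [gg gB]]|nE] := pselect (exists g, idem g /\ gen g = B); last first.
  suff -> : [set g | idem g /\ gen g = B] = set0 by exact: finite_set0.
  by apply/seteqP; split=> // g h; apply: nE; exists g.
apply: (@sub_finite_set _ _ ((fun cd : R * R => f cd.1 * (1 - g) + f cd.2 * g) @`
   ([set c : R | idem c] `*` [set c : R | idem c]))); last first.
  by apply: finite_image; apply: finite_setX; apply: finite_idem.
move=> h [hh hB].
have [a [b hE]] : gen g h.
  by rewrite gB -hB; exists 0, 1; rewrite rmorph0 rmorph1 mul1r add0r.
have [|c cc c1] := @idem_lift a (1 - g) (idemC gg).
  rewrite (_ : f a * (1 - g) = h * (1 - g)); first by apply: idemM => //; apply: idemC.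
  rewrite hE; transitivity (f a * (1 - g) + f b * (g - g * g)); last by ring.
  by rewrite gg; ring.
have [|d dd d1] := @idem_lift (a + b) g gg.
  rewrite (_ : f (a + b) * g = h * g); first exact: idemM.
  rewrite hE rmorphD; transitivity (f a * g + f b * (g * g)); last by ring.
  by rewrite gg; ring.
exists (c, d) => //=; rewrite -c1 -d1 hE rmorphD; ring.
Qed.

(** Each of the finitely many intermediate rings that do not contain T misses
    some element of T; these witnesses generate T. *)
Lemma fg_FIP T : subal f T -> exists2 X : set S, finite_set X /\ X `<=` T &
  forall B, subal f B -> X `<=` B -> T `<=` B.
Proof.
move=> sT.
have [w wP] : exists w : set S -> S, forall B, ~ T `<=` B -> T (w B) /\ ~ B (w B).
  have H B : exists x, ~ T `<=` B -> T x /\ ~ B x.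
    have [TB|nTB] := pselect (T `<=` B); first by exists 0.
    by move: (nTB) => /existsNP[x /not_implyP Px]; exists x.
  by have [w] := choice H; exists w.
exists ((w @` [set C | subal f C]) `&` T).
  by split; [apply: finite_setIl; apply: finite_image|move=> x []].
move=> B sB XB; apply: contrapT => nTB.
by have [Tw nBw] := wP B nTB; apply: nBw; apply: XB; split=> //; exists B.
Qed.

End OverR.
End ZeroDim.

(** * Local idempotents and their residue fields *)
Section LocalIdem.
Variable A : comPzRingType.

(** The ring eA is local with nil maximal ideal. *)
Definition local_idem (e : A) :=
  [/\ idem e, e <> 0 & forall a, nilpot (e * a) \/ exists b, a * b = e].

Lemma primitive_local e :
  (forall a : A, exists b, fitting a b) -> primitive e -> local_idem e.
Proof.
move=> fitA [ee e0 ep]; split=> // a; have [b [idf nf]] := fitA a.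
have [ef|ef] := ep _ idf.
  left; rewrite (_ : e * a = e * ((1 - a * b) * a)); first exact: nilMl.
  by rewrite mulrA mulrBr mulr1 ef subr0.
by right; exists (b * e); rewrite mulrA mulrC.
Qed.

Variable e : A.
Hypothesis le : local_idem e.

Lemma local_unit a : ~ nilpot (e * a) -> exists b, a * b = e.
Proof. by case: le => _ _ /(_ a)[]. Qed.

Lemma local_prime a b : nilpot (e * (a * b)) -> nilpot (e * a) \/ nilpot (e * b).
Proof.
case: le => ee _ /(_ a)[|[c ac] nab]; first by left.
right; rewrite -ee -{2}ac (_ : _ * b = c * (e * (a * b))); first exact: nilMl.
by ring.
Qed.

End LocalIdem.

Section LocalResidue.
Variable R : comNzRingType.
Hypothesis fin : finite_set [set I : set R | ideal_set I].
Variable e : R.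
Hypothesis le : local_idem e.

(** The residue field of eR is infinite: no finite list of elements represents
    all its classes. *)
Definition infinite_residue := forall l : seq R, exists r, forall r0, r0 \in l -> ~ nilpot (e * (r - r0)).

Lemma infinite_residue_pigeon (T : Type) (F : set T) (u : R -> T) : infinite_residue ->
  finite_set F -> (forall r, F (u r)) -> exists r r', u r = u r' /\ ~ nilpot (e * (r - r')).
Proof.
move=> inf finF Fu.
have [rep repP] : exists rep : T -> R, forall r, u (rep (u r)) = u r.
  have H t : exists r, forall r', u r' = t -> u r = t.
    have [[r0 ur0]|nE] := pselect (exists r, u r = t); first by exists r0.
    by exists 0 => r' ur'; case: nE; exists r'.
  by have [g gP] := choice H; exists g => r; apply: (gP (u r) r).
have /finite_seqP[l lE] := finite_image rep finF.
have [r rP] := inf l; exists r, (rep (u r)); split=> //; apply: rP.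
suff : [set` l] (rep (u r)) by [].
by rewrite -lE; exists (u r).
Qed.

(** If the residue field is finite and a R is infinite, then a R is a finite union
    of translates of the union of the ideals a m R, with m nilpotent.  There are
    finitely many of these ideals, so one of them is infinite.  Iterating from e
    gives a chain of ideals generated by multiples by nilpotents, which cannot
    repeat. *)
Lemma infinite_residue_of_infinite : infinite_set (principal e) -> infinite_residue.
Proof.
move=> infe; apply: contrapT => /existsNP[l lP].
have {}lP r : exists2 r0, r0 \in l & nilpot (e * (r - r0)).
  apply: contrapT => nE; apply: lP; exists r => r0 r0l nr; apply: nE; by exists r0.
have ee : idem e by case: le.
have step a : exists m, e * a = a -> infinite_set (principal a) ->
    nilpot m /\ infinite_set (principal (a * m)).
  have [[ea infa]|nE] := pselect (e * a = a /\ infinite_set (principal a)); last first.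
    by exists 0 => ea infa; case: nE.
  apply: contrapT => nE; apply: infa.
  have finm m : nilpot m -> finite_set (principal (a * m)).
    move=> nm; apply: contrapT => infm; apply: nE; exists m => _ _; by split.
  pose aM : set R := [set y | exists2 m, nilpot m & y = a * m].
  have finaM : finite_set aM.
    apply: (@sub_finite_set _ _ (\bigcup_(I in [set I | ideal_set I /\ finite_set I]) I)).
      move=> _ [m nm ->]; exists (principal (a * m)); last exact: principal_self.
      by split; [apply: ideal_set_principal|apply: finm].
    by apply: bigcup_finite => [|I []//]; apply: sub_finite_set fin => I [].
  apply: (@sub_finite_set _ _ ((fun p : R * R => a * p.1 + p.2) @` ([set` l] `*` aM))).
    move=> _ [r ->]; have [r0 r0l nr] := lP r.
    exists (r0, a * (e * (r - r0))) => /=; first by split=> //=; exists (e * (r - r0)).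
    by rewrite mulrA [a * e]mulrC ea; ring.
  by apply: finite_image; apply: finite_setX.
have [m mP] := choice step.
pose u n := iter n (fun a => a * m a) e.
have uP n : e * u n = u n /\ infinite_set (principal (u n)).
  elim: n => [//|n [eu infu]] /=; split; first by rewrite mulrA eu.
  by have [] := mP _ eu infu.
have uij i k : exists2 n, nilpot n & u (i + k.+1)%N = u i * n.
  elim: k => [|k [n nn un]].
    rewrite addn1 /=; exists (m (u i)) => //; have [eu infu] := uP i.
    by have [] := mP _ eu infu.
  exists (n * m (u (i + k.+1)%N)); first exact: nilMr.
  by rewrite addnS /= -/(u _) {1}un mulrA.
have [i [j [ij E]]] := chain_repeat fin (fun n => ideal_set_principal (u n)).
have [n nn un] := uij i (j - i.+1)%N.
rewrite -subSn // subSS subnKC ?(ltnW ij) // in un.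
have [z uz] : principal (u j) (u i) by rewrite -E; apply: principal_self.
have u0 : u i = 0.
  by apply: (@nil_fix _ _ (n * z)); [apply: nilMr|rewrite mulrA -un].
have [_] := uP i; apply; rewrite u0.
apply: (@sub_finite_set _ _ [set 0]); last exact: finite_set1.
by move=> _ [y ->]; rewrite mul0r.
Qed.

(** For two elements a, b of eR, two of the ideals (a + r b) R with distinct
    residues r coincide, and such an ideal contains both a and b.  Hence a maximal
    principal ideal inside the maximal ideal of eR is all of it. *)
Lemma infinite_residue_principal : infinite_residue ->
  exists t, [/\ e * t = t, nilpot t & forall a, nilpot (e * a) -> exists b, e * a = t * b].
Proof.
move=> inf; have ee : idem e by case: le.
have pair a b : e * a = a -> e * b = b -> exists r, principal (a + r * b) a /\ principal (a + r * b) b.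
  move=> ea eb.
  have [r [r' [E nr]]] := infinite_residue_pigeon inf fin (fun r => ideal_set_principal (a + r * b)).
  have [v vE] := local_unit le nr.
  have [I0 ID IM] := ideal_set_principal (a + r * b); exists r.
  have Ib : principal (a + r * b) b.
    have Eb : v * (a + r * b) + (- v) * (a + r' * b) = b.
      by rewrite -[RHS]eb -vE; ring.
    rewrite -[X in principal _ X]Eb.
    by apply: ID; apply: IM; [apply: principal_self|rewrite E; apply: principal_self].
  split=> //; have Ea : (a + r * b) + (- r) * b = a by ring.
  rewrite -[X in principal _ X]Ea.
  by apply: ID; [apply: principal_self|apply: IM].
apply: contrapT => nE.
have step t : exists c, e * t = t -> nilpot t ->
  [/\ e * c = c, nilpot c, principal c t & ~ principal c `<=` principal t].
  have [[et nt]|nE'] := pselect (e * t = t /\ nilpot t); last by exists 0 => ? ?; case: nE'.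
  have [b [nb tb]] : exists b, nilpot (e * b) /\ ~ principal t (e * b).
    apply: contrapT => nE'; apply: nE; exists t; split=> // a na.
    by apply: contrapT => h; apply: nE'; exists a.
  have [|r [Ia Ib]] := pair t (e * b) et; first by rewrite mulrA ee.
  exists (t + r * (e * b)) => _ _; split=> //.
  - by rewrite mulrDr et [e * (r * _)]mulrCA [e * (e * _)]mulrA ee.
  - by apply: nilD => //; apply: nilMl.
  - by move=> /(_ _ Ib).
have [c cP] := choice step.
pose u n := iter n c 0.
have uP n : e * u n = u n /\ nilpot (u n).
  elim: n => [|n [eu nu]] /=; first by split; [rewrite mulr0|apply: nil0].
  by have [] := cP _ eu nu.
have sub I a : ideal_set I -> I a -> principal a `<=` I.
  by case=> _ _ IM Ia _ [z ->]; rewrite mulrC; apply: IM.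
have mono i k : principal (u i) `<=` principal (u (i + k)%N).
  elim: k => [|k IH]; first by rewrite addn0.
  apply: subset_trans IH _; rewrite addnS /=; have [eu nu] := uP (i + k)%N.
  by have [_ _ h _] := cP _ eu nu; apply: sub => //; apply: ideal_set_principal.
have [i [j [ij E]]] := chain_repeat fin (fun n => ideal_set_principal (u n)).
have [eu nu] := uP i; have [_ _ _ h2] := cP _ eu nu.
apply: h2.
by rewrite E -(subnKC ij); apply: (mono i.+1).
Qed.

End LocalResidue.

(** * Elements just above the base ring *)
Section Diag.
Variables (R S1 S2 : comNzRingType) (f1 : {rmorphism R -> S1}) (f2 : {rmorphism R -> S2}).
Definition diag (r : R) : S1 * S2 := (f1 r, f2 r).
Fact diag_zmod : zmod_morphism diag.
Proof. by move=> x y; rewrite /diag !rmorphB. Qed.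
Fact diag_monoid : monoid_morphism diag.
Proof. by split=> [|x y]; rewrite /diag ?rmorph1 // !rmorphM. Qed.
HB.instance Definition _ := GRing.isZmodMorphism.Build _ _ diag diag_zmod.
HB.instance Definition _ := GRing.isMonoidMorphism.Build _ _ diag diag_monoid.
End Diag.

Section Almost.
Variables (R S : comNzRingType) (f : {rmorphism R -> S}).
Hypothesis fI : injective f.
Variable e : R.
Hypothesis le : local_idem e.

Definition in_base (x : S) := exists r, x = f r.

Lemma in_baseM r x : in_base x -> in_base (f r * x).
Proof. by case=> s ->; exists (r * s); rewrite rmorphM. Qed.

(** The nilpotent elements of the local part of S cut out by e. *)
Definition enil (x : S) := f e * x = x /\ nilpot x.

Definition almost_base (x : S) :=
  [/\ enil x, ~ in_base x, in_base (x * x) & forall m, nilpot m -> in_base (f m * x)].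

Lemma enil_base x : enil x -> in_base x -> exists s, [/\ e * s = s, nilpot s & x = f s].
Proof.
case=> ex nx [s xs]; exists s; split=> //.
  by apply: fI; rewrite rmorphM -xs.
by apply: (nil_inj fI); rewrite -xs.
Qed.

Lemma enilM a x : enil x -> enil (a * x).
Proof. by case=> ex nx; split; [rewrite mulrCA ex|apply: nilMl]. Qed.

Lemma enilD x y : enil x -> enil y -> enil (x + y).
Proof. by case=> ex nx [ey ny]; split; [rewrite mulrDr ex ey|apply: nilD]. Qed.

Lemma almost_sq x : almost_base x -> exists s, [/\ e * s = s, nilpot s & x * x = f s].
Proof. by case=> ex _ xx _; apply: enil_base => //; apply: enilM. Qed.

Lemma almost_mul x m : almost_base x -> nilpot m ->
  exists s, [/\ e * s = s, nilpot s & f m * x = f s].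
Proof. by case=> ex _ _ mx nm; apply: enil_base (mx _ nm) => //; apply: enilM. Qed.

Lemma almost_coef x a : almost_base x -> in_base (f a * x) -> nilpot (e * a).
Proof.
case=> [[ex _] nx _ _] ax; apply: contrapT => /(local_unit le)[b ab].
apply: nx; have -> : x = f b * (f a * x) by rewrite -[LHS]ex -ab; ring.
exact: in_baseM.
Qed.

(** The maximal ideal of eR is t R; the value t = 0 is allowed. *)
Definition uniformizer (t : R) :=
  [/\ e * t = t, nilpot t & forall a, nilpot (e * a) -> exists b, e * a = t * b].

(** The last of the squares x0, x0^2, x0^4, ... outside R has its own square in R;
    multiply it by the largest power of t that keeps it outside R. *)
Lemma almost_exists t x0 : uniformizer t -> enil x0 -> ~ in_base x0 ->
  exists x, almost_base x.
Proof.
case=> et nt tP ex0 nx0.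
have [n xn] := ex0.2.
have base0 : in_base 0 by exists 0; rewrite rmorph0.
have [||j [Pj /contrapT Pj1]] := @last_step (fun j => ~ in_base (x0 ^+ (2 ^ j))) n.
- by rewrite expn0 expr1.
- by apply; rewrite -(subnK (ltnW (ltn_expl n (ltnSn 1)))) exprD xn mulr0.
set y := x0 ^+ (2 ^ j) in Pj.
have ey : enil y by rewrite /y -(prednK (expn_gt0 2 j)) exprSr; apply: enilM.
have yy : in_base (y * y) by rewrite -expr2 -exprM mulnC -expnS.
have [k tk] := nt.
have [||i [Pi /contrapT Pi1]] := @last_step (fun i => ~ in_base (f (t ^+ i) * y)) k.
- by rewrite expr0 rmorph1 mul1r.
- by apply; rewrite tk rmorph0 mul0r.
exists (f (t ^+ i) * y); split=> //.
- exact: enilM.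
- by rewrite mulrACA -rmorphM; apply: in_baseM.
- move=> m nm; have [b mb] := tP m (nilMl e nm).
  have -> : f m * (f (t ^+ i) * y) = f b * (f (t ^+ i.+1) * y).
    transitivity (f (e * m) * (f (t ^+ i) * y)).
      by rewrite -[in LHS](proj1 (enilM (f (t ^+ i)) ey)); ring.
    by rewrite mb exprS; ring.
  exact: in_baseM.
Qed.

End Almost.

(** * Infinite families of subalgebras *)
Section Glue.
Variables (R S1 S2 : comNzRingType) (f1 : {rmorphism R -> S1}) (f2 : {rmorphism R -> S2}).
Hypotheses (f1I : injective f1) (f2I : injective f2).
Variable e : R.
Hypotheses (le : local_idem e) (inf : infinite_residue e).
Hypothesis FIPd : finite_set [set C | subal (diag f1 f2) C].

(** The subalgebra [C r] is spanned by (x, r y) over the diagonal and over the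
    pairs (m, 0) with m nilpotent, which absorb the products of x and y. *)
Lemma not_both_almost_base x y : almost_base f1 e x -> almost_base f2 e y -> False.
Proof.
move=> ax ay.
have [s [es ns xx]] := almost_sq f1I ax.
have [s' [es' ns' yy]] := almost_sq f2I ay.
pose C r : set (S1 * S2) := [set z | exists c a m, nilpot m /\
  (z = (f1 c + f1 a * x + f1 m, f2 c + f2 (r * a) * y))].
have sC r : subal (diag f1 f2) (C r).
  split.
  - move=> c; exists c, 0, 0; split; first exact: nil0.
    by congr pair; rewrite ?mulr0 !rmorph0 !mul0r ?addr0.
  - move=> _ _ [c [a [m [nm ->]]]] [c' [a' [m' [nm' ->]]]].
    exists (c - c'), (a - a'), (m - m'); split; first exact: nilB.
    by congr pair; rewrite /=; ring.
  - move=> _ _ [c [a [m [nm ->]]]] [c' [a' [m' [nm' ->]]]].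
    have [k [ek nk xm]] := almost_mul f1I ax nm.
    have [k' [ek' nk' xm']] := almost_mul f1I ax nm'.
    pose w := r * r * a * a' * s'.
    pose z := a * a' * s + a * k' + a' * k + c * m' + c' * m + m * m'.
    exists (c * c' + w), (c * a' + c' * a), (z - w); split.
    + by apply: nilB; [do 5?apply: nilD; apply: nilMl|apply: nilMl].
    + congr pair; rewrite /= /w /z.
      * transitivity (f1 (c * c') + f1 (c * a' + c' * a) * x + (f1 (a * a') * (x * x)
          + f1 a * (f1 m' * x) + f1 a' * (f1 m * x) + f1 (c * m' + c' * m + m * m'))); first by ring.
        by rewrite xx xm xm'; ring.
      * transitivity (f2 (c * c') + f2 (r * (c * a' + c' * a)) * y + f2 (r * r * a * a') * (y * y)); first by ring.
        by rewrite yy; ring.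
have [r [r' [E nr]]] := infinite_residue_pigeon inf FIPd sC.
have : C r (x, f2 r * y).
  exists 0, 1, 0; split; first exact: nil0.
  by rewrite !rmorph0 !rmorph1 mulr1 mul1r !add0r addr0.
rewrite E => -[c [a [m [nm [xE yE]]]]].
have na : nilpot (e * (1 - a)).
  apply: (almost_coef le ax); exists (c + m).
  by rewrite rmorphB rmorph1 mulrBl mul1r {1}xE; ring.
have nb : nilpot (e * (r - r' * a)).
  apply: (almost_coef le ay); exists c.
  by rewrite rmorphB mulrBl yE; ring.
apply: nr; have -> : e * (r - r') = e * (r - r' * a) - r' * (e * (1 - a)) by ring.
by apply: nilB => //; apply: nilMl.
Qed.

Variable t : R.
Hypotheses (ut : uniformizer e t) (t0 : t <> 0).

(** In these relations u is a unit of eR and v is its inverse there. *)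
Definition special_elt (S : comNzRingType) (f : R -> S) (x : S) :=
  [/\ t * t = 0, f t * x = 0 & exists u v, u * v = e /\ x * x = f (u * t)].

(** Write t x = t b and x^2 = u t.  As x is nilpotent, so is e b.  If e u were
    nilpotent too, R (x + r t) + t^2 R would be an ideal of R + R x for every r,
    and these ideals, hence the gluings [C r] of R + R x and R along them, would
    be pairwise distinct.  So u is a unit, and t^2 = v t x^2 lies in t^3 R. *)
Lemma almost_special x : almost_base f1 e x -> special_elt f1 x.
Proof.
move=> ax; have ee : e * e = e by case: le.
have [et nt tP] := ut; have [[ex nx] xb _ _] := ax.
have tS s : e * s = s -> nilpot s -> exists b, s = t * b.
  move=> es ns; have [|b] := tP s; first by rewrite es.
  by rewrite es => sb; exists b.
have [w [ew nw tx]] := almost_mul f1I ax nt.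
have [b wb] := tS w ew nw.
have nb : nilpot (e * b).
  apply: contrapT => /(local_unit le)[b' bb].
  apply: t0; apply: f1I; rewrite rmorph0; apply: (@nil_fix _ _ (x * f1 b')); first exact: nilMr.
  by rewrite mulrA tx wb -rmorphM -mulrA bb mulrC et.
have [b1 eb1] := tP b nb.
have {}tx : f1 t * x = f1 (t * t * b1).
  by rewrite tx wb -{1}et mulrC mulrA [b * e]mulrC eb1; congr (f1 _); ring.
have [s [es ns xx]] := almost_sq f1I ax.
have [u su] := tS s es ns; rewrite {}su in xx.
have nu : ~ nilpot (e * u).
  move=> nu; have [u1 eu1] := tP u nu.
  have {}xx : x * x = f1 (t * t * u1).
    by rewrite xx -{1}et mulrC mulrA [u * e]mulrC eu1; congr (f1 _); ring.
  pose C r : set (S1 * S2) := [set z | exists c a d,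
    z = (f1 c + f1 a * (x + f1 (r * t)) + f1 (t * t * d), f2 c)].
  have sC r : subal (diag f1 f2) (C r).
    split.
    - move=> c; exists c, 0, 0.
      by congr pair; rewrite ?mulr0 !rmorph0 !mul0r ?addr0.
    - move=> _ _ [c [a [d ->]]] [c' [a' [d' ->]]].
      exists (c - c'), (a - a'), (d - d').
      by congr pair; rewrite /=; ring.
    - move=> _ _ [c [a [d ->]]] [c' [a' [d' ->]]].
      exists (c * c'), (c * a' + c' * a), (a * a' * (u1 + (r + r) * b1 + r * r)
        + a * d' * (t * b1 + r * t) + a' * d * (t * b1 + r * t)
        + c * d' + c' * d + t * t * d * d').
      congr pair; rewrite /=; last by ring.
      transitivity (f1 (c * c') + f1 (c * a' + c' * a) * (x + f1 (r * t)) +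
        (f1 (a * a') * (x * x + f1 ((r + r)) * (f1 t * x) + f1 (r * r * t * t))
         + f1 (a * d' * t) * (f1 t * x) + f1 (a' * d * t) * (f1 t * x)
         + f1 (t * t * (a * d' * (r * t) + a' * d * (r * t) + c * d' + c' * d + t * t * d * d')))); first by ring.
      rewrite tx xx; ring.
  have [r [r' [E nr]]] := infinite_residue_pigeon inf FIPd sC.
  have : C r (x + f1 (r * t), 0).
    exists 0, 1, 0; rewrite mulr0 !rmorph0 rmorph1 add0r mul1r addr0; by [].
  rewrite E => -[c [a [d [xE cE]]]].
  have {cE} c0 : c = 0 by apply: f2I; rewrite -cE rmorph0.
  have na : nilpot (e * (1 - a)).
    apply: (almost_coef le ax); exists (a * (r' * t) - r * t + t * t * d).
    transitivity ((x + f1 (r * t)) - f1 a * x - f1 (r * t)); first by ring.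
    by rewrite xE c0; ring.
  have [w1 aw1] := tP _ na.
  have [v rv] := local_unit le nr.
  apply: t0; apply: (@nil_fix _ _ (t * (d - b1 * w1 - w1 * r') * v)).
    by do 2 apply: nilMr.
  apply: f1I.
  have Ax : f1 (1 - a) * x = f1 w1 * (f1 t * x).
    by rewrite -{1}ex mulrA -rmorphM [_ * e]mulrC aw1; ring.
  have At : (1 - a) * r' * t = t * w1 * r' * t.
    by rewrite -{1}et -aw1; ring.
  have E1 : f1 ((r - r') * t) = f1 (t * t) * f1 (d - b1 * w1 - w1 * r').
    transitivity (f1 (t * t * d) - f1 (1 - a) * x - f1 ((1 - a) * r' * t)).
      transitivity (x + f1 (r * t) - x - f1 (r' * t)); first by ring.
      by rewrite xE c0; ring.
    by rewrite Ax tx At; ring.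
  transitivity (f1 ((r - r') * t) * f1 v); last by rewrite E1; ring.
  by rewrite -rmorphM -{1}et -rv; congr (f1 _); ring.
have [v uv] := local_unit le nu.
have tt : t * t = 0.
  apply: (@nil_fix _ _ (t * v * b1 * b1)); first by do 3 apply: nilMr.
  apply: f1I.
  transitivity (f1 v * f1 t * (x * x)); first by rewrite xx -{1}et -uv; ring.
  transitivity (f1 v * (f1 t * x) * x); first by ring.
  transitivity (f1 (v * t * b1) * (f1 t * x)); first by rewrite {1}tx; ring.
  by rewrite tx; ring.
split=> //; first by rewrite tx tt mul0r rmorph0.
by exists u, v; split=> //; rewrite xx mulrC.
Qed.

End Glue.

Section Span.
Variables (R S : comNzRingType) (f : {rmorphism R -> S}).
Hypothesis fI : injective f.
Variable e : R.
Hypotheses (le : local_idem e) (inf : infinite_residue e).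
Hypothesis FIPf : finite_set [set C | subal f C].
Variable t : R.
Hypotheses (ut : uniformizer e t) (t0 : t <> 0).

Definition lin_span (x y : S) := exists a b, y = f a + f b * x.

Variables (x : S) (ax : almost_base f e x) (sx : special_elt e t f x).

Lemma subal_span : subal f (lin_span x).
Proof.
have [_ _ [s xs] _] := ax; split.
- by move=> r; exists r, 0; rewrite rmorph0 mul0r addr0.
- move=> _ _ [a [b ->]] [a' [b' ->]]; exists (a - a'), (b - b'); ring.
- move=> _ _ [a [b ->]] [a' [b' ->]].
  exists (a * a' + b * b' * s), (a * b' + a' * b).
  transitivity (f (a * a') + f (b * b') * (x * x) + f (a * b' + a' * b) * x); first by ring.
  by rewrite xs; ring.
Qed.

(** The constant coefficient of a nilpotent combination is itself nilpotent, hence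
    a multiple of t. *)
Lemma span_enil w : lin_span x w -> enil f e w -> exists a b, w = f (t * a) + f b * x /\ e * b = b.
Proof.
have [et nt tP] := ut; have [[ex nx] _ _ _] := ax.
have ee : e * e = e by case: le.
case=> a [b wE] [ew nw].
have wE' : w = f (e * a) + f (e * b) * x by rewrite -ew wE; ring.
have [|c ac] := tP a.
  apply: (nil_inj fI); rewrite (_ : f (e * a) = w - f (e * b) * x); last by rewrite wE'; ring.
  by apply: nilB => //; apply: nilMl.
by exists c, (e * b); rewrite -ac; split; rewrite // mulrA ee.
Qed.

(** Otherwise, replacing z0 by a power and then by a multiple by a power of x,
    there is z outside T = R + R x with z^2 and x z in T.  Since t is a multiple
    of x^2, one gets t z = 0, and subtracting a multiple of x gives z' with
    x z' = 0 and z'^2 in R.  The rings generated by x + r z' are then infinitely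
    many. *)
Lemma enil_span z0 : enil f e z0 -> lin_span x z0.
Proof.
move=> ez0; apply: contrapT => nz0.
have sT := subal_span.
have [et nt tP] := ut; have [ex xb _ _] := ax.
have ee : e * e = e by case: le.
have [tt tx [u [v [uv xx]]]] := sx.
have [n zn] := ez0.2.
have Tx : lin_span x x by exists 0, 1; rewrite rmorph0 rmorph1 add0r mul1r.
have [||j [Pj /contrapT Pj1]] := @last_step (fun j => ~ lin_span x (z0 ^+ (2 ^ j))) n.
- by rewrite expn0 expr1.
- by apply; rewrite -(subnK (ltnW (ltn_expl n (ltnSn 1)))) exprD zn mulr0; apply: (subal0 sT).
set y := z0 ^+ (2 ^ j) in Pj.
have ey : enil f e y by rewrite /y -(prednK (expn_gt0 2 j)) exprSr; apply: enilM.
have yy : lin_span x (y * y) by rewrite -expr2 -exprM mulnC -expnS.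
have [k xk] := ex.2.
have [||i [Pi /contrapT Pi1]] := @last_step (fun i => ~ lin_span x (x ^+ i * y)) k.
- by rewrite expr0 mul1r.
- by apply; rewrite xk mul0r; apply: (subal0 sT).
set z := x ^+ i * y in Pi.
have ez : enil f e z by apply: enilM.
have Tzz : lin_span x (z * z).
  by rewrite mulrACA; apply: (subalM sT) => //; apply: (subalM sT); apply: (subalX sT).
rewrite exprS -mulrA -/z in Pi1.
have [b [bt [xz eb]]] := span_enil Pi1 (enilM x ez).
have vut : v * u * t = t by rewrite [v * u]mulrC uv et.
have tz0 : f t * z = f (bt * t).
  rewrite -{1}vut; transitivity (f v * (f (u * t) * z)); first by ring.
  rewrite -xx; transitivity (f v * x * (x * z)); first by ring.
  rewrite xz; transitivity (f (v * b) * (f t * x) + f (v * bt) * (x * x)); first by ring.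
  rewrite tx xx mulr0 add0r -rmorphM; congr (f _).
  by rewrite -{2}vut; ring.
have nbt : nilpot (e * bt).
  apply: contrapT => /(local_unit le)[c bc]; apply: t0; apply: fI; rewrite rmorph0.
  apply: (@nil_fix _ _ (f c * z)); first by apply: nilMl; case: ez.
  by rewrite mulrCA tz0 -rmorphM -{1}et -bc; congr (f _); ring.
have [b1 b1E] := tP _ nbt; rewrite eb in b1E.
have tz : f t * z = 0 by rewrite tz0 b1E mulrAC tt mul0r rmorph0.
have {}xz : x * z = f (t * b).
  rewrite xz b1E (_ : f (t * b1) * x = f b1 * (f t * x)); last by ring.
  by rewrite tx mulr0 addr0.
pose z' := z - f (b * v) * x.
have ez' : enil f e z'.
  by rewrite /z' -mulNr; apply: enilD => //; apply: enilM.
have xz' : x * z' = 0.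
  have -> : x * z' = x * z - f (b * v) * (x * x) by rewrite /z'; ring.
  by rewrite xx xz -{1}vut; ring.
have tz' : f t * z' = 0 by rewrite mulrBr tz mulrCA tx mulr0 subr0.
have Tz' : ~ lin_span x z'.
  move=> h; apply: Pi; rewrite -(subrK (f (b * v) * x) z); apply: (subalD sT) => //.
  by apply: (subalM sT) => //; apply: (subal_base sT).
have Tzz' : lin_span x (z' * z').
  rewrite (_ : z' * z' = z * z - f (b * v + b * v) * (x * z) + f (b * v * (b * v)) * (x * x)); last by rewrite /z'; ring.
  rewrite xz xx; apply: (subalD sT); last by apply: (subalM sT); apply: (subal_base sT).
  by apply: (subalB sT) => //; apply: (subalM sT); apply: (subal_base sT).
have [c [g [zz eg]]] := span_enil Tzz' (enilM z' ez').
have ng : nilpot (e * g).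
  apply: contrapT => /(local_unit le)[h gh]; apply: t0; apply: fI; rewrite rmorph0.
  have : x * (z' * z') = 0 by rewrite mulrA xz' mul0r.
  rewrite zz (_ : x * _ = f c * (f t * x) + f g * (x * x)); last by ring.
  rewrite tx xx mulr0 add0r => gut.
  transitivity (f (h * v) * (f g * f (u * t))); last by rewrite gut mulr0.
  by rewrite -{1}et -{1}vut -gh; ring.
have [g1 g1E] := tP _ ng; rewrite eg in g1E.
have {}zz : z' * z' = f (t * c).
  rewrite zz g1E (_ : f (t * g1) * x = f g1 * (f t * x)); last by ring.
  by rewrite tx mulr0 addr0.
pose C r : set S := [set w | exists a b, w = f a + f b * (x + f r * z')].
have sC r : subal f (C r).
  split.
  - by move=> s; exists s, 0; rewrite rmorph0 mul0r addr0.
  - move=> _ _ [a1 [a2 ->]] [a1' [a2' ->]]; exists (a1 - a1'), (a2 - a2'); ring.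
  - move=> _ _ [a1 [a2 ->]] [a1' [a2' ->]].
    exists (a1 * a1' + a2 * a2' * (u * t + r * r * (t * c))), (a1 * a2' + a1' * a2).
    transitivity (f (a1 * a1') + f (a2 * a2') * (x * x + f (r + r) * (x * z') + f (r * r) * (z' * z'))
      + f (a1 * a2' + a1' * a2) * (x + f r * z')); first by ring.
    by rewrite xx xz' zz; ring.
have [r [r' [E nr]]] := infinite_residue_pigeon inf FIPf sC.
have : C r (x + f r * z') by exists 0, 1; rewrite rmorph0 rmorph1 add0r mul1r.
rewrite E => -[a1 [a2 xE]].
have n1 : nilpot (e * (r - a2 * r')).
  apply: contrapT => /(local_unit le)[h rh]; apply: Tz'.
  exists (h * a1), (h * (a2 - 1)).
  have -> : z' = f h * (x + f r * z' - x - f (a2 * r') * z').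
    by rewrite -{1}ez'.1 -rh; ring.
  by rewrite xE; ring.
have n2 : nilpot (e * (1 - a2)).
  have [c1 c1E] := tP _ n1.
  have Z : f (r - a2 * r') * z' = 0.
    rewrite -ez'.1 mulrA -rmorphM [_ * e]mulrC c1E (_ : f (t * c1) * z' = f c1 * (f t * z')); last by ring.
    by rewrite tz' mulr0.
  apply: (almost_coef le ax); exists a1.
  transitivity ((x + f r * z') - f a2 * (x + f r' * z') - f (r - a2 * r') * z'); first by ring.
  by rewrite Z xE; ring.
apply: nr; rewrite (_ : e * (r - r') = e * (r - a2 * r') - r' * (e * (1 - a2))); last by ring.
by apply: nilB => //; apply: nilMl.
Qed.

End Span.

(** * Roots modulo nilpotents *)
Section Roots.
Variable A : comNzRingType.

(** The usual division by X - a, for the domain obtained from hA modulo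
    nilpotents. *)
Lemma local_roots (h : A) : local_idem h -> forall n (q : {poly A}), (size q <= n)%N ->
  (exists i, ~ nilpot (h * q`_i)) ->
  exists l : seq A, forall y, nilpot (h * q.[y]) -> exists2 y0, y0 \in l & nilpot (h * (y - y0)).
Proof.
move=> lh; elim=> [|n IH] q sq [i qi].
  by case: qi; rewrite nth_default ?mulr0; [apply: nil0|apply: leq_trans sq _].
have [[a qa]|nE] := pselect (exists a, nilpot (h * q.[a])); last first.
  by exists [::] => y qy; case: nE; exists y.
have /factor_theorem [p pE] : root (q - q.[a]%:P) a by rewrite /root !hornerE subrr.
have qE : q = p * ('X - a%:P) + q.[a]%:P by rewrite -pE subrK.
have [j pj] : exists j, ~ nilpot (h * p`_j).
  apply: contrapT => nE; apply: qi.
  have np j : nilpot (h * p`_j) by apply: contrapT => h'; apply: nE; exists j.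
  rewrite {1}qE mulrBr coefD coefB coefMX coefMC coefC mulrDr mulrBr mulrA.
  apply: nilD; last by case: eqP => _ //; rewrite mulr0; apply: nil0.
  apply: nilB; last exact: nilMr.
  by case: eqP => _ //; rewrite mulr0; apply: nil0.
have p0 : p != 0 by apply/eqP => p0; apply: pj; rewrite p0 coef0 mulr0; apply: nil0.
have sp : (size p <= n)%N.
  have : (size (p * ('X - a%:P))).-1 = size p by rewrite size_Mmonic ?monicXsubC // size_XsubC addn2.
  rewrite -pE => <-.
  have /(leq_trans (size_polyD _ _)) : (maxn (size q) (size (- q.[a]%:P)) <= n.+1)%N.
    by rewrite geq_max sq size_polyN size_polyC; case: (_ != 0).
  by case: (size _).
have [|l lP] := IH p sp; first by exists j.
exists (a :: l) => y qy.
have : nilpot (h * (p.[y] * (y - a))).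
  have -> : p.[y] * (y - a) = q.[y] - q.[a].
    by move/(congr1 (horner^~ y)): qE; rewrite !hornerE => ->; ring.
  by rewrite mulrBr; apply: nilB.
case/(local_prime lh) => [/lP [y0 y0l n0]|na].
  by exists y0 => //; rewrite inE y0l orbT.
by exists a => //; rewrite inE eqxx.
Qed.

Hypotheses (finA : finite_set [set g : A | idem g])
  (fitA : forall a : A, exists b, fitting a b).

(** On each primitive idempotent, the coefficient 1 keeps q nonzero. *)
Lemma finite_roots (q : {poly A}) i : q`_i = 1 -> forall h, idem h ->
  exists l : seq A, forall y, nilpot (h * q.[y]) -> exists2 y0, y0 \in l & nilpot (h * (y - y0)).
Proof.
move=> qi; apply: (idem_ind finA).
- by exists [:: 0] => y _; exists 0; rewrite ?inE // mul0r; apply: nil0.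
- move=> h g hh gg hg [l lP] [l' lP'].
  exists [seq h * u + g * v | u <- l, v <- l'] => y ny.
  have nh : nilpot (h * q.[y]).
    rewrite (_ : _ * _ = h * ((h + g) * q.[y])); first exact: nilMl.
    by rewrite mulrA mulrDr hh hg addr0.
  have ng : nilpot (g * q.[y]).
    rewrite (_ : _ * _ = g * ((h + g) * q.[y])); first exact: nilMl.
    by rewrite mulrA mulrDr gg [g * h]mulrC hg add0r.
  have [u ul nu] := lP y nh; have [v vl nv] := lP' y ng.
  exists (h * u + g * v); first exact: allpairs_f.
  rewrite (_ : _ * _ = h * (y - u) + g * (y - v)); first exact: nilD.
  transitivity ((h + g) * y - (h * h) * u - (g * g) * v - h * g * (u + v)); first by ring.
  by rewrite hh gg hg; ring.
- move=> h ph; have lh := primitive_local fitA ph.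
  apply: (local_roots lh (leqnn _)); exists i; rewrite qi mulr1 => nh.
  by case: ph => hh h0 _; apply: h0; apply: nil_idem.
Qed.

End Roots.

(** * Subalgebras of a product containing the nilpotents of one factor *)
Section Projections.
Variables (R S1 S2 : comNzRingType) (f1 : {rmorphism R -> S1}) (f2 : {rmorphism R -> S2}).

Definition proj1 (C : set (S1 * S2)) : set S1 := [set x | exists y, C (x, y)].
Definition proj2 (C : set (S1 * S2)) : set S2 := [set y | exists x, C (x, y)].

Variable C : set (S1 * S2).
Hypothesis sC : subal (diag f1 f2) C.

Lemma subal_proj1 : subal f1 (proj1 C).
Proof.
split; first by move=> r; exists (f2 r); apply: (subal_base sC).
  by move=> x x' [y Cxy] [y' Cxy']; exists (y - y'); apply: (subalB sC Cxy Cxy').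
by move=> x x' [y Cxy] [y' Cxy']; exists (y * y'); apply: (subalM sC Cxy Cxy').
Qed.

Lemma subal_proj2 : subal f2 (proj2 C).
Proof.
split; first by move=> r; exists (f1 r); apply: (subal_base sC).
  by move=> x x' [y Cxy] [y' Cxy']; exists (y - y'); apply: (subalB sC Cxy Cxy').
by move=> x x' [y Cxy] [y' Cxy']; exists (y * y'); apply: (subalM sC Cxy Cxy').
Qed.

Lemma ev_diag p a b : ev (diag f1 f2) p (a, b) = (ev f1 p a, ev f2 p b).
Proof.
elim/poly_ind: p => [|p c IH]; first by rewrite /ev !rmorph0 !horner0.
by rewrite !evD !evM !evX !evC IH.
Qed.

Lemma algebraic_diag a b : algebraic f1 a -> algebraic f2 b -> algebraic (diag f1 f2) (a, b).
Proof.
case=> n [q [q0 aq]] [m [p [p0 bp]]]; exists (n + m)%N, (q * p).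
rewrite hornerM q0 p0 mulr1 ev_diag !evM; split=> //.
have -> : (a, b) ^+ (n + m) = (a ^+ (n + m), b ^+ (n + m)).
  by elim: (n + m)%N => // k IH; rewrite !exprS IH.
congr pair; rewrite /= exprD.
  by rewrite mulrACA aq mul0r.
by rewrite mulrACA bp mulr0.
Qed.

Lemma mem_pairM a b a' b' : C (a, b) -> C (a', b') -> C (a * a', b * b').
Proof. by move=> h h'; apply: (subalM sC h h'). Qed.
Lemma mem_pairD a b a' b' : C (a, b) -> C (a', b') -> C (a + a', b + b').
Proof. by move=> h h'; apply: (subalD sC h h'). Qed.
Lemma mem_pairB a b a' b' : C (a, b) -> C (a', b') -> C (a - a', b - b').
Proof. by move=> h h'; apply: (subalB sC h h'). Qed.

Lemma mem_pairX a b n : C (a, b) -> C (a ^+ n, b ^+ n).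
Proof.
move=> h; elim: n => [|n IH]; first exact: (subal1 sC).
by rewrite !exprS; apply: mem_pairM.
Qed.

End Projections.

Section Reduced.
Variables (R S1 S2 : comNzRingType) (f1 : {rmorphism R -> S1}) (f2 : {rmorphism R -> S2}).
Hypotheses (fin : finite_set [set I : set R | ideal_set I])
  (FIP1 : finite_set [set C | subal f1 C]) (FIP2 : finite_set [set C | subal f2 C]).

Let dsub D := subal (diag f1 f2) D.

Lemma fitting_proj2 (T : set S2) a : subal f2 T -> T a -> exists2 b, T b & fitting a b.
Proof. by move=> sT Ta; apply: (fitting_subal sT Ta); apply: algebraic_FIP. Qed.

(** Modulo nilpotents, the ideal of the i with (0, i) in D is generated by its
    largest idempotent. *)
Lemma largest_idem_ideal2 D : dsub D -> exists g, [/\ idem g, D (0, g)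
  & forall i, D (0, i) -> nilpot ((1 - g) * i)].
Proof.
move=> sD.
have [|||g [[gg Dg] gP]] := @idem_max _ (finite_idem_FIP fin FIP2) (fun g => idem g /\ D (0, g)).
- by split; [rewrite /idem mulr0|apply: (subal0 sD)].
- by move=> f [].
- move=> f g [ff Df] [gg Dg]; split.
    rewrite /idem; transitivity (f * f + g * g + (f * g + f * g) - f * f * (g + g) - g * g * (f + f) + f * f * (g * g)); first by ring.
    by rewrite ff gg; ring.
  have := mem_pairB sD (mem_pairD sD Df Dg) (mem_pairM sD Df Dg).
  by rewrite mulr0 addr0 subr0.
exists g; split=> // i Di.
have [b [w Dwb] [idf nf]] := fitting_proj2 (subal_proj2 sD) (ex_intro _ _ Di).
have fg : i * b * g = i * b.
  by apply: gP; split=> //; have := mem_pairM sD Di Dwb; rewrite mul0r.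
rewrite (_ : _ * i = (1 - g) * ((1 - i * b) * i)); first exact: nilMl.
transitivity ((1 - g) * i - (i * b - i * b * g) * i); last by ring.
by rewrite fg subrr mul0r subr0.
Qed.

(** Two subalgebras with the same projections and the same g agree as soon as
    each generator x of the first projection has a common partner.  Partners of
    x in D satisfy (1 - g) q(y) nilpotent, where q is a polynomial killing x;
    recording the root y0 of q that is close to y on 1 - g is therefore enough. *)
Lemma finite_subal_over_nil :
  finite_set [set D | dsub D /\ forall n, nilpot n -> D (0, n)].
Proof.
have finI := finite_idem_FIP fin FIP2.
have fitS2 (a : S2) : exists b, fitting a b.
  by have [|b _ ab] := @fitting_proj2 setT a _ I; [split|exists b].
have [X XP] : exists X : set S1 -> set S1, forall T, subal f1 T ->
    [/\ finite_set (X T), X T `<=` T & forall B, subal f1 B -> X T `<=` B -> T `<=` B].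
  have H T : exists X, subal f1 T -> [/\ finite_set X, X `<=` T & forall B, subal f1 B -> X `<=` B -> T `<=` B].
    have [sT|nT] := pselect (subal f1 T); last by exists set0.
    by have [X [X1 X2] X3] := fg_FIP FIP1 sT; exists X.
  by have [X] := choice H; exists X.
have [q qP] : exists q : S1 -> {poly R}, forall x, (exists i, (q x)`_i = 1) /\ ev f1 (q x) x = 0.
  have H x : exists q : {poly R}, (exists i, q`_i = 1) /\ ev f1 q x = 0.
    have [n [q [q0 xq]]] := algebraic_FIP fin FIP1 x.
    exists ('X^n * q); split; last by rewrite evM evexp evX.
    by exists n; rewrite coefXnM ltnn subnn -horner_coef0.
  by have [q] := choice H; exists q.
have [L LP] : exists L : S1 * S2 -> seq S2, forall xg, idem xg.2 ->
    forall y, nilpot ((1 - xg.2) * ev f2 (q xg.1) y) ->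
    exists2 y0, y0 \in L xg & nilpot ((1 - xg.2) * (y - y0)).
  have H (xg : S1 * S2) : exists l : seq S2, idem xg.2 -> forall y, nilpot ((1 - xg.2) * ev f2 (q xg.1) y) ->
      exists2 y0, y0 \in l & nilpot ((1 - xg.2) * (y - y0)).
    have [gg|ng] := pselect (idem xg.2); last by exists [::].
    have [[i qi] _] := qP xg.1.
    have [|l lP] := @finite_roots _ finI fitS2 (map_poly f2 (q xg.1)) i _ _ (idemC gg).
      by rewrite coef_map /= qi rmorph1.
    by exists l.
  by have [L] := choice H; exists L.
pose Xs : set S1 := \bigcup_(T in [set T | subal f1 T]) X T.
have finX : finite_set Xs by apply: bigcup_finite => // T /XP[].
pose Z : set (S1 * S2) := \bigcup_(xg in Xs `*` [set g | idem g]) ([set xg.1] `*` [set` L xg]).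
have finZ : finite_set Z.
  by apply: bigcup_finite => [|xg _]; apply: finite_setX => //; apply: finite_set1.
pose B := [set T | subal f1 T] `*` [set T | subal f2 T] `*` [set g : S2 | idem g]
   `*` [set V | V `<=` Z].
have finB : finite_set B.
  by do 3 ?[apply: finite_setX]; rewrite //; apply: finite_powerset.
pose V (D : set (S1 * S2)) (g : S2) : set (S1 * S2) :=
  [set u | Z u /\ exists y, D (u.1, y) /\ nilpot ((1 - g) * (y - u.2))].
pose isg (D : set (S1 * S2)) (g : S2) := [/\ idem g, D (0, g) & forall i, D (0, i) -> nilpot ((1 - g) * i)].
apply: (finite_by_data (rel := fun D b => [/\ b.1.1.1 = proj1 D, b.1.1.2 = proj2 D,
   isg D b.1.2 & b.2 = V D b.1.2]) finB).
  move=> D [sD _]; have [g gP] := largest_idem_ideal2 sD.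
  exists (proj1 D, proj2 D, g, V D g) => //.
  split; last by move=> u [].
  split; last by case: gP.
  by split; [apply: subal_proj1 sD|apply: subal_proj2 sD].
suff main D D' g : dsub D -> dsub D' -> (forall n, nilpot n -> D' (0, n)) ->
    proj1 D = proj1 D' -> proj2 D = proj2 D' -> isg D g -> isg D' g -> V D g = V D' g -> D `<=` D'.
  move=> D D' [[[T1 T2] g] W] [sD nD] [sD' nD'] /= [-> -> gD ->] [pD qD gD' vD].
  by apply/seteqP; split; apply: (main _ _ g).
move=> sD sD' nD' p12 q12 [gg Dg gD] [_ D'g gD'] EV.
have g2 y : proj2 D y -> D' (0, g * y).
  by rewrite q12 => -[z Dzy]; have := mem_pairM sD' D'g Dzy; rewrite mul0r.
have inI i : D (0, i) -> D' (0, i).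
  move=> Di; rewrite (_ : (0, i) = (0 + 0, g * i + (1 - g) * i)); last by congr pair; ring.
  by apply: (mem_pairD sD'); [apply: g2; exists 0|apply: nD'; apply: gD].
pose B0 := [set x | exists y, D (x, y) /\ D' (x, y)].
have sB0 : subal f1 B0.
  split.
  - by move=> r; exists (f2 r); split; [apply: (subal_base sD)|apply: (subal_base sD')].
  - by move=> x x' [y [h1 h2]] [y' [h3 h4]]; exists (y - y'); split; [apply: (mem_pairB sD)|apply: (mem_pairB sD')].
  - by move=> x x' [y [h1 h2]] [y' [h3 h4]]; exists (y * y'); split; [apply: (mem_pairM sD)|apply: (mem_pairM sD')].
have sT := subal_proj1 sD; have [_ XT XB] := XP _ sT.
have TB : proj1 D `<=` B0.
  apply: XB => // x Xx; have [y Dxy] := XT x Xx.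
  have ny : nilpot ((1 - g) * ev f2 (q x) y).
    by apply: gD; have := subal_ev (q x) sD Dxy; rewrite ev_diag (qP x).2.
  have [y0 y0L ny0] := LP (x, g) gg y ny.
  have : V D g (x, y0).
    split; last by exists y.
    exists (x, g); last by split.
    by split=> //; exists (proj1 D).
  rewrite EV => -[_ [y' [/= D'xy' ny0']]].
  exists y; split=> //.
  have y2 : proj2 D y by exists x.
  have y2' : proj2 D y' by rewrite q12; exists x.
  have -> : (x, y) = (x + 0 + (0 - 0), y' + (1 - g) * (y - y') + (g * y - g * y')) by congr pair; ring.
  apply: (mem_pairD sD'); last by apply: (mem_pairB sD'); apply: g2.
  apply: (mem_pairD sD') => //; apply: nD'.
  by rewrite (_ : _ * _ = (1 - g) * (y - y0) - (1 - g) * (y' - y0)); [apply: nilB|ring].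
move=> [x w] Dxw; have [y [Dxy D'xy]] : B0 x by apply: TB; exists w.
have -> : (x, w) = (x + 0, y + (w - y)) by congr pair; ring.
apply: (mem_pairD sD') => //; apply: inI.
by have := mem_pairB sD Dxw Dxy; rewrite subrr.
Qed.

End Reduced.

(** * Finite local components *)
Section FiniteFixed.
Variables (R S : comNzRingType) (f : {rmorphism R -> S}).
Hypotheses (fin : finite_set [set I : set R | ideal_set I])
  (FIPf : finite_set [set C | subal f C]).
Variable e : R.
Hypothesis le : local_idem e.

(** Truncate a polynomial killing a after its last coefficient that is a unit of
    eR: the truncation takes an e-nilpotent value at a, and some power of it
    vanishes there.  The factor X ensures a positive degree. *)
Lemma local_integral (a : S) :
  exists2 h : {poly R}, (1 < size h)%N /\ h \is monic & f e * ev f h a = 0.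
Proof.
have ee : e * e = e by case: le.
have [n [q0 [q00 aq0]]] := algebraic_FIP fin FIPf a.
pose q := 'X^n * q0.
have qn : q`_n = 1 by rewrite coefXnM ltnn subnn -horner_coef0.
have qa : ev f q a = 0 by rewrite evM evexp evX.
pose P i := `[< ~ nilpot (e * q`_i) >].
have exP : exists i, P i.
  exists n; apply/asboolP; rewrite qn mulr1 => ne.
  by case: le => _ e0 _; apply: e0; apply: nil_idem.
have bndP i : P i -> (i <= size q)%N.
  move=> /asboolP Pi; rewrite leqNgt; apply/negP => lt; apply: Pi.
  by rewrite nth_default ?mulr0; [apply: nil0|apply: ltnW].
case: (ex_maxnP exP bndP) => d /asboolP Pd dmax.
have [b qb] := local_unit le Pd.
pose q1 := take_poly d.+1 q.
have nq1 : nilpot (f e * ev f q1 a).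
  rewrite (_ : _ * _ = - (f e * ev f (q - q1) a)); last by rewrite evB qa sub0r mulrN opprK.
  apply: nilN; rewrite ev_sum mulr_sumr; apply: nil_sum => i _.
  rewrite mulrA -rmorphM; apply: nilMr; apply: nil_morph.
  rewrite coefB coef_take_poly; case: ltnP => di; first by rewrite subrr mulr0; apply: nil0.
  rewrite subr0; apply: contrapT => nP.
  by have := dmax i (introT (asboolP _) nP); rewrite leqNgt di.
pose h0 := b%:P * q1 + (1 - e)%:P * 'X^d.
have h0d : h0`_d = 1.
  by rewrite coefD !coefCM coef_take_poly ltnSn coefXn eqxx mulr1 mulrC qb addrC subrK.
have sh0 : (size h0 <= d.+1)%N.
  apply: leq_trans (size_polyD _ _) _; rewrite geq_max.
  rewrite !mul_polyC !(leq_trans (size_scale_leq _ _)) ?size_polyXn //.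
  exact: size_take_poly.
have sh0' : size h0 = d.+1.
  apply/eqP; rewrite eqn_leq sh0 ltnNge; apply/negP => lt.
  by have := oner_neq0 R; rewrite -h0d nth_default ?eqxx.
have mh0 : h0 \is monic by rewrite monicE lead_coefE sh0' /= h0d.
have [k hk] : nilpot (f e * ev f h0 a).
  rewrite (_ : _ * _ = f b * (f e * ev f q1 a)); first exact: nilMl.
  rewrite evD !evM !evC evexp evX.
  transitivity (f b * (f e * ev f q1 a) + f (e - e * e) * a ^+ d); first by ring.
  by rewrite ee subrr rmorph0 mul0r addr0.
exists (h0 ^+ k * 'X).
  have mk : h0 ^+ k \is monic by rewrite monic_exp.
  by rewrite size_mulX ?monic_neq0 // ltnS lt0n size_poly_eq0 monic_neq0 // monicMl ?monicX.
rewrite evM evexp evX mulrA.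
case: k hk => [|k] hk; first by move/eqP: hk; rewrite expr0 oner_eq0.
by rewrite -(idemX k (f := f e)) -?exprMn ?hk ?mul0r // -rmorphM ee.
Qed.

Hypothesis fine : finite_set (principal e).

(** With a monic polynomial of degree N + 1 killing a in the e-part, e B[a] is
    made of the combinations of 1, ..., a^N with coefficients in e B. *)
Lemma finite_adjoin (B : set S) (a : S) : subal f B ->
  finite_set [set y | exists2 b, B b & y = f e * b] ->
  exists B', [/\ subal f B', B `<=` B', B' a &
    finite_set [set y | exists2 b, B' b & y = f e * b]].
Proof.
move=> sB; set eB := [set y | _] => fineB.
have ee : e * e = e by case: le.
have [h [sh mh] ha] := local_integral a.
pose B' : set S := [set y | exists2 p : {poly S}, forall i, B p`_i & y = p.[a]].
have sB' : subal f B'.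
  split.
  - move=> r; exists (f r)%:P; last by rewrite hornerC.
    by move=> i; rewrite coefC; case: eqP => _; [apply: subal_base|apply: subal0 sB].
  - move=> _ _ [p pB ->] [q qB ->]; exists (p - q); last by rewrite hornerD hornerN.
    by move=> i; rewrite coefB; apply: (subalB sB).
  - move=> _ _ [p pB ->] [q qB ->]; exists (p * q); last by rewrite hornerM.
    move=> i; rewrite coefM; apply: (big_ind B); first exact: (subal0 sB).
      by move=> *; apply: (subalD sB).
    by move=> j _; apply: (subalM sB).
pose W n : set S := [set y | exists2 b : nat -> S, forall i, eB (b i) & y = \sum_(i < n) b i * a ^+ i].
have eB0 : eB 0 by exists 0; [apply: (subal0 sB)|rewrite mulr0].
have eBD x y : eB x -> eB y -> eB (x + y).
  by move=> [b Bb ->] [c Bc ->]; exists (b + c); [apply: (subalD sB)|rewrite mulrDr].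
have eBM x r : eB x -> eB (x * f r).
  by move=> [b Bb ->]; exists (b * f r); [apply: (subalM sB) => //; apply: subal_base|rewrite mulrA].
have WD n x y : W n x -> W n y -> W n (x + y).
  move=> [b Bb ->] [c Bc ->]; exists (fun i => b i + c i); first by move=> i; apply: eBD.
  by rewrite -big_split; apply: eq_bigr => i _; rewrite mulrDl.
have finW n : finite_set (W n).
  elim: n => [|n IH].
    apply: (@sub_finite_set _ _ [set 0]); last exact: finite_set1.
    by move=> _ [b _ ->]; rewrite big_ord0.
  apply: (@sub_finite_set _ _ ((fun p : S * S => p.1 + p.2 * a ^+ n) @` (W n `*` eB))).
    move=> _ [b bP ->]; exists (\sum_(i < n) b i * a ^+ i, b n) => /=; last by rewrite big_ord_recr.
    by split=> //=; exists b.
  by apply: finite_image; apply: finite_setX.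
set N := (size h).-2.
have sN : size h = N.+2 by rewrite /N; case: (size h) sh => [|[]].
have hN : f e * a ^+ N.+1 = \sum_(i < N.+1) f (- e * h`_i) * a ^+ i.
  have := ha; rewrite ev_sum sN big_ord_recr /=.
  have -> : h`_N.+1 = 1 by rewrite -(monicP mh) lead_coefE sN.
  rewrite rmorph1 mul1r mulrDr => /eqP; rewrite addrC addr_eq0 => /eqP ->.
  rewrite mulr_sumr -sumrN; apply: eq_bigr => i _.
  by rewrite mulNr rmorphN rmorphM; ring.
have WX y : W N.+1 y -> W N.+1 (y * a).
  move=> [b bP ->].
  rewrite big_ord_recr /= mulrDl -mulrA -exprSr.
  apply: WD.
    exists (fun i => if i is j.+1 then b j else 0); first by case.
    rewrite big_ord_recl mul0r add0r mulr_suml; apply: eq_bigr => i _.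
    by rewrite /bump /= -mulrA -exprSr.
  exists (fun i => b N * f (- e * h`_i)); first by move=> i; apply: eBM.
  have -> : b N = b N * f e.
    by have [c _ ->] := bP N; rewrite mulrAC -rmorphM ee.
  rewrite -mulrA hN mulr_sumr; apply: eq_bigr => i _.
  rewrite !mulrA -[_ * f e * _]mulrA -rmorphM; congr (_ * f _ * _).
  by rewrite !mulNr mulrN mulrA ee.
exists B'; split=> //.
- move=> b Bb; exists b%:P; last by rewrite hornerC.
  by move=> i; rewrite coefC; case: eqP => // _; apply: (subal0 sB).
- exists 'X; last by rewrite hornerX.
  by move=> i; rewrite coefX; case: eqP => _; [apply: (subal1 sB)|apply: (subal0 sB)].
apply: sub_finite_set (finW N.+1) => _ [_ [p pB ->] ->].
elim/poly_ind: p pB => [|p c IH] pB.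
  exists (fun=> 0) => //; rewrite horner0 mulr0 big1 // => i _.
  by rewrite mul0r.
rewrite hornerMXaddC mulrDr mulrA; apply: WD.
  apply: WX; apply: IH => i.
  by have := pB i.+1; rewrite coefD coefMX coefC /= addr0.
exists (fun i => if i is 0%N then f e * c else 0).
  case=> // ; exists c => //.
  by have := pB 0%N; rewrite coefD coefMX coefC /= add0r.
by rewrite big_ord_recl /= mulr1 big1 ?addr0 // => i _; rewrite mul0r.
Qed.

Lemma finite_fixed : finite_set [set y : S | f e * y = y].
Proof.
have sT : subal f setT by split.
have [X [finX _] XP] := fg_FIP FIPf sT.
have [s sE] := (finite_seqP _).1 finX.
have [B [sB sub finB]] : exists B, [/\ subal f B, [set` s] `<=` B &
   finite_set [set y | exists2 b, B b & y = f e * b]].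
  elim: (s) => [|a r [B [sB rB finB]]].
    exists (range f); split; [exact: subal_base_ring|by []|].
    apply: (sub_finite_set _ (finite_image f fine)) => _ [_ [c _ <-] ->].
    by exists (e * c); [exists c|rewrite rmorphM].
  have [B' [sB' BB' Ba finB']] := finite_adjoin a sB finB.
  exists B'; split=> // x /=; rewrite inE => /predU1P[->//|xr].
  by apply: BB'; apply: rB.
have BT : setT `<=` B by apply: XP => //; rewrite sE.
by apply: sub_finite_set finB => y /= ey; exists y; [apply: BT|].
Qed.

End FiniteFixed.

(** * Subalgebras of a product, one local component at a time *)
Section LocalParts.
Variables (R S1 S2 : comNzRingType) (f1 : {rmorphism R -> S1}) (f2 : {rmorphism R -> S2}).
Local Notation d := (diag f1 f2).

Definition epart (e : R) (C : set (S1 * S2)) : set (S1 * S2) := [set z | C z /\ d e * z = z].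

Definition finite_parts (e : R) :=
  finite_set ((fun C => epart e C) @` [set C | subal d C]).

Lemma epart_mul e C z : subal d C -> e * e = e -> C z -> epart e C (d e * z).
Proof.
move=> sC ee Cz; split; first by apply: (subalM sC) => //; apply: (subal_base sC).
by rewrite mulrA -rmorphM ee.
Qed.

(** Subalgebras contain the idempotents of R, hence they are recovered from their
    components along orthogonal idempotents. *)
Lemma finite_parts_glue (fin : finite_set [set I : set R | ideal_set I]) :
  (forall e : R, primitive e -> finite_parts e) -> finite_set [set C | subal d C].
Proof.
move=> Hp.
suff H1 : finite_parts 1.
  apply: (sub_finite_set _ H1) => C sC; exists C => //.
  by apply/seteqP; split=> [z []//|z Cz]; split=> //; rewrite rmorph1 mul1r.
have id1 : idem (1 : R) by rewrite /idem mulr1.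
apply: (idem_ind (finite_idem fin)) id1 => //.
- apply: (@sub_finite_set _ _ [set [set 0]]); last exact: finite_set1.
  move=> _ [C sC <-]; apply/seteqP; split=> z; rewrite /epart /= rmorph0 mul0r.
    by case.
  by move=> ->; split=> //; apply: (subal0 sC).
- move=> e f ee ff ef He Hf.
  apply: (finite_by_data (rel := fun B b => exists2 C, subal d C &
    B = epart (e + f) C /\ b = (epart e C, epart f C)) (finite_setX He Hf)).
    move=> _ [C sC <-]; exists (epart e C, epart f C); last by exists C.
    by split; exists C.
  suff main C C' : subal d C -> subal d C' -> epart e C = epart e C' -> epart f C = epart f C' ->
      epart (e + f) C `<=` epart (e + f) C'.
    move=> _ _ b _ _ [C sC [-> ->]] [C' sC' [-> [eE fE]]].
    by apply/seteqP; split; apply: main.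
  move=> sC sC' eE fE z [Cz zE]; split=> //.
  have : epart e C (d e * z) by apply: epart_mul.
  rewrite eE => -[h1 _].
  have : epart f C (d f * z) by apply: epart_mul.
  rewrite fE => -[h2 _].
  by rewrite -zE rmorphD mulrDl; apply: (subalD sC').
Qed.

Section Local.
Hypotheses (fin : finite_set [set I : set R | ideal_set I])
  (FIP1 : finite_set [set C | subal f1 C]) (FIP2 : finite_set [set C | subal f2 C]).
Hypotheses (f1I : injective f1) (f2I : injective f2).
Variable e : R.
Hypothesis le : local_idem e.

Lemma finite_parts_finite : finite_set (principal e) -> finite_parts e.
Proof.
move=> fine.
have fin1 := finite_fixed fin FIP1 le fine; have fin2 := finite_fixed fin FIP2 le fine.
apply: (sub_finite_set _ (finite_powerset (finite_setX fin1 fin2))).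
by move=> _ [C _ <-] [x y] [_ [/= ex ey]]; split.
Qed.

Hypothesis base2 : forall y, enil f2 e y -> in_base f2 y.

Definition addnil (C : set (S1 * S2)) : set (S1 * S2) :=
  [set z | exists2 n, nilpot n & C (z.1, z.2 - n)].

Definition coincide (C : set (S1 * S2)) : set R := [set r | C (f1 (e * r), 0)].

Lemma sub_addnil C : C `<=` addnil C.
Proof. by move=> [x y] Cxy; exists 0; [apply: nil0|rewrite subr0]. Qed.

Lemma subal_addnil C : subal d C -> subal d (addnil C).
Proof.
move=> sC; split.
- by move=> r; apply: sub_addnil; apply: (subal_base sC).
- move=> [x y] [x' y'] [n nn Cn] [m nm Cm]; exists (n - m); first exact: nilB.
  rewrite /= (_ : y - y' - (n - m) = (y - n) - (y' - m)); last by ring.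
  exact: (mem_pairB sC).
- move=> [x y] [x' y'] [n nn Cn] [m nm Cm].
  exists (y * m + (y' - m) * n); first by apply: nilD; apply: nilMl.
  rewrite /= (_ : y * y' - _ = (y - n) * (y' - m)); last by ring.
  exact: (mem_pairM sC).
Qed.

Lemma proj1_addnil C : proj1 (addnil C) = proj1 C.
Proof.
apply/seteqP; split=> x [y]; last by move=> Cxy; exists y; apply: sub_addnil.
by case=> n _ Cxy; exists (y - n).
Qed.

Lemma ideal_set_coincide C : subal d C -> ideal_set (coincide C).
Proof.
move=> sC; split.
- by rewrite /coincide /= mulr0 rmorph0; apply: (subal0 sC).
- move=> r s Cr Cs; have := mem_pairD sC Cr Cs.
  by rewrite /coincide /= -rmorphD -mulrDr addr0.
- move=> a r Cr; have := mem_pairM sC (subal_base sC a) Cr.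
  by rewrite /coincide /= -rmorphM mulr0 mulrCA.
Qed.

Lemma base2_nil y : enil f2 e y -> exists s, [/\ e * s = s, nilpot s & y = f2 s].
Proof. by move=> ey; apply: (enil_base f2I ey); apply: base2. Qed.

Lemma fixed_pair x y : d e * (x, y) = (x, y) -> f1 e * x = x /\ f2 e * y = y.
Proof. by case. Qed.

(** A partner y of n can be replaced by (1 - g) y, where g is the Fitting
    idempotent of y: as n is nilpotent, (0, g) is in C. *)
Lemma nil_lift C n : subal d C -> proj1 C n -> enil f1 e n ->
  exists s, [/\ e * s = s, nilpot s & C (n, f2 s)].
Proof.
move=> sC [y Cny] [en nn].
have ee : e * e = e by case: le.
have {y Cny} [m nm Cm] : exists2 m, nilpot m & C (n, m).
  have y2 : proj2 C y by exists n.
  have [b [w Cwb] [idf nf]] := fitting_proj2 fin FIP2 (subal_proj2 sC) y2.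
  have [k nk] := nn; exists ((1 - y * b) * y) => //.
  have := mem_pairX sC k.+1 (mem_pairM sC Cny Cwb).
  rewrite (idemX _ idf) exprMn exprS nk mulr0 mul0r => Cf.
  have := mem_pairB sC Cny (mem_pairM sC Cf Cny).
  by rewrite mul0r subr0 (_ : y - _ = (1 - y * b) * y) //; ring.
have [|s [es ns sE]] := @base2_nil (f2 e * m).
  by split; [rewrite mulrA -rmorphM ee|apply: nilMl].
exists s; split=> //; rewrite -sE -en.
exact: (mem_pairM sC (subal_base sC e) Cm).
Qed.

Lemma move_nil C C' x y : subal d C -> subal d C' -> addnil C = addnil C' ->
  C (x, y) -> d e * (x, y) = (x, y) ->
  exists r, [/\ e * r = r, nilpot r & C' (x + f1 r, y)].
Proof.
move=> sC sC' E Cxy /fixed_pair [ex ey].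
have ee : e * e = e by case: le.
have : addnil C (x, y) by apply: sub_addnil.
rewrite E => -[n nn /= C'n].
have [|s [es ns sE]] := @base2_nil (f2 e * n).
  by split; [rewrite mulrA -rmorphM ee|apply: nilMl].
exists s; split=> //.
have := mem_pairD sC' (mem_pairM sC' (subal_base sC' e) C'n) (subal_base sC' s).
by rewrite /= mulrBr ex ey sE subrK.
Qed.

Lemma nil_absorbed C C' : subal d C -> subal d C' -> addnil C = addnil C' ->
  (forall n, proj1 C n -> enil f1 e n -> C' (n, 0)) ->
  epart e C `<=` epart e C'.
Proof.
move=> sC sC' E beta [x y] [Cxy exy]; split=> //.
have [r [er nr C'r]] := move_nil sC sC' E Cxy exy.
have sP := subal_proj1 sC.
have : C' (f1 r, 0).
  apply: beta; last by split; [rewrite -rmorphM er|apply: nil_morph].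
  exact: (subal_base sP).
by move=> /(mem_pairB sC' C'r); rewrite addrK subr0.
Qed.

(** Subtracting a diagonal element, one may assume that x annihilates the maximal
    ideal of eR.  On its Fitting idempotent F, the element (x, y) is unaffected by
    an error (f1 r, 0) with r nilpotent, since x kills it; and powers remove
    the error on F itself.  The remaining part of (x, y) is nilpotent, and the
    nilpotents of C are sums of diagonal elements and of elements (f1 s, 0)
    recorded by [coincide]. *)
Lemma nil_in_base t C C' : uniformizer e t -> subal d C -> subal d C' ->
  addnil C = addnil C' -> coincide C = coincide C' ->
  (forall n, proj1 C n -> enil f1 e n -> in_base f1 n) ->
  epart e C `<=` epart e C'.
Proof.
move=> [et nt tP] sC sC' E EK alpha [x0 y0] [Cxy0 exy0]; split=> //.
have ee : e * e = e by case: le.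
have [ex0 ey0] := fixed_pair exy0.
have sP := subal_proj1 sC.
(* x0 acts on the maximal ideal as a scalar b *)
have [b xb] : exists b, x0 * f1 t = f1 (t * b).
  have ex0t : enil f1 e (x0 * f1 t).
    by split; [rewrite mulrA ex0|apply: nilMl; apply: nil_morph].
  have [|s [es ns sE]] := enil_base f1I ex0t.
    apply: alpha => //; apply: (subalM sP); last exact: (subal_base sP).
    by exists y0.
  have [|b sb] := tP s; first by rewrite es.
  by exists b; rewrite sE -sb es.
pose x := x0 - f1 (e * b); pose y := y0 - f2 (e * b).
have Cxy : C (x, y) by apply: (mem_pairB sC Cxy0 (subal_base sC (e * b))).
have exy : d e * (x, y) = (x, y).
  by congr pair; rewrite /= mulrBr ?ex0 ?ey0 -rmorphM mulrA ee.
suff : C' (x, y).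
  by move=> h; have := mem_pairD sC' h (subal_base sC' (e * b)); rewrite !subrK.
have xm m : e * m = m -> nilpot m -> x * f1 m = 0.
  move=> em nm; have [|c mc] := tP m; first by rewrite em.
  rewrite -em mc /x.
  transitivity (x0 * f1 t * f1 c - f1 (e * t * b * c)); first by ring.
  by rewrite xb et; ring.
have [ex ey] := fixed_pair exy.
have [|[w v] Cwv [idF nF]] := fitting_subal sC Cxy.
  by apply: algebraic_diag; apply: algebraic_FIP.
have {idF} [idF1 idF2] : idem (x * w) /\ idem (y * v) by case: idF.
have CF : C (x * w, y * v) by apply: (mem_pairM sC Cxy Cwv).
have eF : d e * (x * w, y * v) = (x * w, y * v).
  by congr pair; rewrite /= mulrA ?ex ?ey.
have C'N : C' ((1 - x * w) * x, (1 - y * v) * y).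
  have CN : C ((1 - x * w) * x, (1 - y * v) * y).
    have := mem_pairB sC Cxy (mem_pairM sC CF Cxy).
    by congr C; congr pair; ring.
  have [k [nk1 nk2]] : exists k, ((1 - x * w) * x) ^+ k = 0 /\ ((1 - y * v) * y) ^+ k = 0.
    have [k kE] := nF; exists k.
    have EX (a : S1) (c : S2) : (a, c) ^+ k = (a ^+ k, c ^+ k).
      by elim: k {kE} => // k IH; rewrite !exprS IH.
    by move: kE; rewrite [X in X ^+ k](_ : _ = ((1 - x * w) * x, (1 - y * v) * y)) // EX => -[].
  have [s1 [es1 ns1 sE1]] : exists s, [/\ e * s = s, nilpot s & (1 - x * w) * x = f1 s].
    have en : enil f1 e ((1 - x * w) * x) by split; [rewrite mulrCA ex|exists k].
    by apply: (enil_base f1I en); apply: alpha => //; exists ((1 - y * v) * y).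
  have [|s2 [es2 ns2 sE2]] := @base2_nil ((1 - y * v) * y).
    by split; [rewrite mulrCA ey|exists k].
  rewrite sE1 sE2 in CN *.
  have : coincide C (s1 - s2).
    rewrite /coincide /= mulrBr es1 es2.
    by have := mem_pairB sC CN (subal_base sC s2); rewrite subrr -rmorphB.
  rewrite EK /coincide /= mulrBr es1 es2 => h.
  by have := mem_pairD sC' h (subal_base sC' s2); rewrite add0r -rmorphD subrK.
have C'F : C' (x * w, y * v).
  have [r [er nr C'r]] := move_nil sC sC' E CF eF.
  have xr : x * w * f1 r = 0 by rewrite mulrAC xm ?mul0r.
  have [k rk] := nr.
  have := mem_pairX sC' k.+1 C'r; rewrite (idemX _ idF2).
  suff -> : (x * w + f1 r) ^+ k.+1 = x * w by [].
  have H n : (x * w + f1 r) ^+ n.+1 = x * w + f1 (r ^+ n.+1).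
    elim: n => [|n IH]; first by rewrite !expr1.
    rewrite exprS IH [r ^+ n.+2]exprS rmorphM.
    transitivity (x * w * (x * w) + (x * w * f1 r) * (1 + f1 (r ^+ n)) + f1 r * f1 (r ^+ n.+1)); first by rewrite [r ^+ n.+1]exprS; ring.
    by rewrite idF1 xr mul0r addr0.
  by rewrite H exprS rk mulr0 rmorph0 addr0.
have C'Fz : C' (x * w * x, y * v * y).
  have [r [er nr C'r]] := move_nil sC sC' E Cxy exy.
  have := mem_pairM sC' C'F C'r; rewrite mulrDr.
  by rewrite [x * w * f1 r]mulrAC xm // mul0r addr0.
have := mem_pairD sC' C'Fz C'N.
by congr C'; congr pair; ring.
Qed.

(** The hypotheses of [nil_in_base] and of [nil_absorbed]; the choice depends only
    on the first projection T. *)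
Definition nil_dichotomy := forall T, subal f1 T ->
  (forall n, T n -> enil f1 e n -> in_base f1 n) \/
  (forall C, subal d C -> proj1 C = T -> forall n, T n -> enil f1 e n -> C (n, 0)).

Lemma finite_parts_local : (exists t, uniformizer e t) -> nil_dichotomy -> finite_parts e.
Proof.
move=> [t ut] dich.
apply: (finite_by_data (rel := fun B b => exists2 C, subal d C &
    B = epart e C /\ b = (addnil C, coincide C)) (finite_setX (finite_subal_over_nil fin FIP1 FIP2) fin)).
  move=> _ [C sC <-]; exists (addnil C, coincide C); last by exists C.
  split=> /=; last exact: ideal_set_coincide.
  split; first exact: subal_addnil.
  by move=> n nn; exists n => //; rewrite /= subrr; apply: (subal0 sC).
suff main C C' : subal d C -> subal d C' -> addnil C = addnil C' -> coincide C = coincide C' ->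
    epart e C `<=` epart e C'.
  move=> _ _ b _ _ [C sC [-> ->]] [C' sC' [-> [E EK]]].
  by apply/seteqP; split; apply: main.
move=> sC sC' E EK.
have pE : proj1 C' = proj1 C by rewrite -proj1_addnil -E proj1_addnil.
have [alpha|beta] := dich _ (subal_proj1 sC).
  exact: (nil_in_base ut).
by apply: (nil_absorbed sC sC' E) => n; apply: (beta C').
Qed.

Lemma dichotomy_field : (forall r, nilpot r -> e * r = 0) -> nil_dichotomy.
Proof.
move=> eM T sT; right=> C sC CT n Tn en.
rewrite -CT in Tn; have [s [es ns Cs]] := nil_lift sC Tn en.
by move: Cs; rewrite -es eM // rmorph0.
Qed.

Lemma dichotomy_base : (forall n, enil f1 e n -> in_base f1 n) -> nil_dichotomy.
Proof. by move=> H T sT; left=> n _; apply: H. Qed.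

(** Let J be the set of the n with (n, 0) in C.  An e-nilpotent of T is the sum of an
    element of J and of a nilpotent of R.  As the latter annihilates nilpotents, a
    product of two e-nilpotents is in J, and such products generate the maximal
    ideal of eR. *)
Lemma dichotomy_special :
  (forall T, subal f1 T -> (forall n, T n -> enil f1 e n -> in_base f1 n) \/
     (forall n, enil f1 e n -> T n)) ->
  (forall r n, e * r = r -> nilpot r -> enil f1 e n -> f1 r * n = 0) ->
  (forall r, e * r = r -> nilpot r -> exists N (a b : 'I_N -> S1),
     (forall i, enil f1 e (a i) /\ enil f1 e (b i)) /\ f1 r = \sum_(i < N) a i * b i) ->
  nil_dichotomy.
Proof.
move=> Tmin MN NN T sT; have [|Tall] := Tmin T sT; first by left.
right=> C sC CT n0 Tn0 en0.
have lift n : enil f1 e n -> exists s, [/\ e * s = s, nilpot s & C (n - f1 s, 0)].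
  move=> en; have pn : proj1 C n by rewrite CT; apply: Tall.
  have [s [es ns Cs]] := nil_lift sC pn en; exists s; split=> //.
  by have := mem_pairB sC Cs (subal_base sC s); rewrite subrr.
have enb s : e * s = s -> nilpot s -> enil f1 e (f1 s).
  by move=> es ns; split; [rewrite -rmorphM es|apply: nil_morph].
have base r : e * r = r -> nilpot r -> C (f1 r, 0).
  move=> er nr; have [N [a [b [ab ->]]]] := NN r er nr.
  apply: (big_ind (fun x => C (x, 0))); first exact: (subal0 sC).
    by move=> x y Cx Cy; have := mem_pairD sC Cx Cy; rewrite addr0.
  move=> i _; have [ea eb] := ab i.
  have [s [es ns Cs]] := lift _ ea; have [s' [es' ns' Cs']] := lift _ eb.
  have := mem_pairM sC Cs Cs'; rewrite mulr0.
  rewrite (_ : _ * _ = a i * b i - f1 s * b i - f1 s' * a i + f1 s * f1 s'); last by ring.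
  by rewrite !MN ?subr0 ?addr0 //; apply: enb.
have [s [es ns Cs]] := lift _ en0.
by have := mem_pairD sC Cs (base s es ns); rewrite subrK addr0.
Qed.

End Local.
End LocalParts.

(** * Recognizing special minimal ramified extensions *)
Lemma inj_surj_bij (T U : Type) (g : T -> U) :
  injective g -> (forall y, exists x, g x = y) -> bijective g.
Proof.
move=> gI gS; have [h hP] := choice gS.
by exists h => // x; apply: gI; rewrite hP.
Qed.

Lemma quasi_local_unique (C : comPzRingType) (P : {pred C}) :
  maximal_ideal P -> (forall y, y \notin P -> exists z, y * z = 1) -> quasi_local_with P.
Proof.
move=> mP uP J; split=> [[[J0 JD] J1 Jmax]|JP].
  have sub : {subset J <= P}.
    move=> y yJ; apply: contrapT => /negP /uP[z yz].
    by case/negP: J1; have := JD z y 0 yJ J0; rewrite addr0 [_ *: _]mulrC yz.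
  have [iP P1 _] := mP; have [PJ|PT] := Jmax _ iP sub; first by move=> y; rewrite PJ.
  by move: P1; rewrite PT inE.
have [[P0 PD] P1 Pmax] := mP; split.
- by split=> [|a y z]; rewrite !JP //; apply: PD.
- by rewrite JP.
- move=> K iK sub; have [|PK|KT] := Pmax K iK; first by move=> y yP; apply: sub; rewrite JP.
    by left=> y; rewrite PK JP.
  by right.
Qed.

(** If y were outside P, then 1 = a + b y with a in P; take powers of b y. *)
Lemma maximal_nil (C : comPzRingType) (P : {pred C}) y : maximal_ideal P -> nilpot y -> y \in P.
Proof.
move=> [[P0 PD] P1 Pmax] [k yk].
have PM c z : z \in P -> c * z \in P.
  by move=> zP; have := PD c z 0 zP P0; rewrite addr0.
have PD' a b : a \in P -> b \in P -> a + b \in P.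
  by move=> aP bP; have := PD 1 a b aP bP; rewrite scale1r.
pose J : {pred C} := fun z => `[< exists a b, a \in P /\ z = a + b * y >].
have iJ : is_ideal J.
  split; first by apply/asboolP; exists 0, 0; rewrite mul0r addr0.
  move=> c _ _ /asboolP[a [b [aP ->]]] /asboolP[a' [b' [aP' ->]]]; apply/asboolP.
  exists (c * a + a'), (c * b + b'); split; first by apply: PD' => //; apply: PM.
  by rewrite [_ *: _]mulrDr; ring.
have [|JP|JT] := Pmax J iJ.
- by move=> a aP; apply/asboolP; exists a, 0; rewrite mul0r addr0.
- by rewrite -JP; apply/asboolP; exists 0, 1; rewrite mul1r add0r.
- have : 1 \in J by rewrite JT.
  move=> /asboolP[a [b [aP E]]]; case/negP: P1.
  have {}E : 1 = (b * y) + a by rewrite addrC.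
  suff H n : 1 - (b * y) ^+ n \in P.
    by have := H k; rewrite exprMn yk mulr0 subr0.
  elim: n => [|n IH]; first by rewrite subrr.
  rewrite (_ : _ - _ = (b * y) * (1 - (b * y) ^+ n) + a); first by apply: PD' => //; apply: PM.
  by rewrite {1}E exprS; ring.
Qed.

Lemma ringquot_ind (C : comPzRingType) (I : submodClosed C^o) (T : ringquot I -> Prop) :
  (forall y, T (ringquot_pi I y)) -> forall q, T q.
Proof. exact: (@modquot_ind C C^o I T). Qed.

Lemma ringquot_eq (C : comPzRingType) (I : submodClosed C^o) y z :
  ringquot_pi I y = ringquot_pi I z <-> y - z \in I.
Proof. by split=> [/eqP|H]; [rewrite modquot_eq|apply/eqP; rewrite modquot_eq]. Qed.

Lemma ringquot_piM (C : comPzRingType) (I : submodClosed C^o) y z :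
  ringquot_pi I y * ringquot_pi I z = ringquot_pi I (y * z).
Proof. exact: ringquot_mulE. Qed.

Lemma ringquot_piD (C : comPzRingType) (I : submodClosed C^o) y z :
  ringquot_pi I y + ringquot_pi I z = ringquot_pi I (y + z).
Proof. by rewrite /ringquot_pi -modquot_piD. Qed.

Section Special.
Variables (A B : comPzRingType) (f : {rmorphism A -> B}).
Hypothesis fI : injective f.
Variables (t u v : A) (x : B).
Hypotheses (hloc : forall a, (exists b, a = t * b) \/ (exists b, a * b = 1))
  (t0 : t <> 0) (tt : t * t = 0) (tx : f t * x = 0) (uv : u * v = 1)
  (xx : x * x = f (u * t)) (gen : forall y, exists a b, y = f a + f b * x)
  (nx : forall a, x <> f a).

(** The maximal ideals of A and B. *)
Let M : {pred A} := fun a => `[< exists b, a = t * b >].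
Let N : {pred B} := fun y => `[< exists a b, y = f (t * a) + f b * x >].

Lemma in_M a : a \in M <-> exists b, a = t * b.
Proof. by split=> /asboolP. Qed.
Lemma in_N y : y \in N <-> exists a b, y = f (t * a) + f b * x.
Proof. by split=> /asboolP. Qed.

Lemma t_notunit b c : t * b * c = 1 -> False.
Proof.
by move=> h; apply: t0; rewrite -[t]mulr1 -h -mulrA mulrA tt mul0r.
Qed.

Lemma one_notin_M : 1 \notin M.
Proof.
by apply/negP => /in_M[b h]; apply: (@t_notunit b 1); rewrite mulr1.
Qed.

Lemma coef_M a b : f a * x = f b -> a \in M.
Proof.
move=> h; apply/in_M; have [//|[c ac]] := hloc a.
case: (nx (a := c * b)); rewrite rmorphM -h mulrA -rmorphM mulrC [c * a]mulrC ac.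
by rewrite rmorph1 mulr1.
Qed.

Lemma M_x a : a \in M -> f a * x = 0.
Proof. by move=> /in_M[b ->]; rewrite rmorphM mulrAC tx mul0r. Qed.

Lemma conductorP a : a \in conductor f <-> a \in M.
Proof.
split=> [/asboolP /(_ x)[z az]|aM]; first exact: coef_M az.
apply/asboolP => y; have [c [d ->]] := gen y.
by exists (a * c); rewrite mulrDr mulrCA M_x // mulr0 addr0 rmorphM.
Qed.

Lemma conductor_imageP y : y \in conductor_image f <-> exists b, y = f (t * b).
Proof.
split=> [/asboolP[a /conductorP /in_M[b ->] ->]|[b ->]]; first by exists b.
by apply/asboolP; exists (t * b) => //; apply/conductorP/in_M; exists b.
Qed.

Lemma ideal_M : is_ideal M.
Proof.
split; first by apply/in_M; exists 0; rewrite mulr0.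
move=> a _ _ /in_M[b ->] /in_M[c ->]; apply/in_M; exists (a * b + c).
by rewrite mulrDr mulrCA.
Qed.

Lemma N_mul y z : z \in N -> y * z \in N.
Proof.
move=> /in_N[a [b ->]]; have [c [d ->]] := gen y; apply/in_N.
exists (c * a + d * b * u), (c * b).
transitivity (f (t * (c * a)) + f (c * b) * x + f (d * a) * (f t * x) + f (d * b) * (x * x)); first by ring.
by rewrite tx xx; ring.
Qed.

Lemma submod_N : GRing.submod_closed (N : {pred B^o}).
Proof.
split; first by apply/in_N; exists 0, 0; rewrite !(mulr0, rmorph0) mul0r addr0.
move=> c y z yN /in_N[a [b ->]].
have /in_N[a' [b' E]] := N_mul c yN; apply/in_N; exists (a' + a), (b' + b).
by rewrite [c *: y]E; ring.
Qed.

(** Since n = t a + b x satisfies n^3 = 0, the inverse is 1 - n + n^2. *)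
Lemma unit_one_add_nil a b : exists c, (f (1 + t * a) + f b * x) * c = 1.
Proof.
exists (f (1 - t * a) - f b * x + f (b * b * u * t)).
transitivity (1 - f (t * t) * (f (a * a) - f (a * b * b * u)) - f (b * b) * (x * x - f (u * t))
  + (f (b * b * b * u) - f (a * b + a * b)) * (f t * x)); first by ring.
by rewrite tt tx xx subrr rmorph0 mul0r !mulr0 !subr0 addr0.
Qed.

Lemma maximal_M : maximal_ideal M.
Proof.
split; [exact: ideal_M|exact: one_notin_M|].
move=> J [J0 JD] sub; have [h|h] := pselect (exists a, a \in J /\ a \notin M); last first.
  left=> a; apply/idP/idP => [aJ|/sub //].
  by apply: contrapT => aM; apply: h; exists a; split=> //; apply/negP.
case: h => a [aJ aM]; right=> b; rewrite inE.
have [/in_M|[c ac]] := hloc a; first by rewrite (negPf aM).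
by have := JD (b * c) a 0 aJ J0; rewrite addr0 [_ *: _]mulrAC -mulrA ac mulr1.
Qed.

Lemma one_notin_N : 1 \notin N.
Proof.
apply/negP => /in_N[a [b h]].
have /M_x bx : b \in M.
  by apply: (@coef_M b (1 - t * a)); rewrite rmorphB rmorph1 h addrAC subrr add0r.
apply: (@t_notunit a 1); apply: fI.
by rewrite mulr1 rmorph1 h bx addr0.
Qed.

Lemma maximal_N : maximal_ideal N.
Proof.
split; [exact: submod_N|exact: one_notin_N|].
move=> J [J0 JD] sub; have [h|h] := pselect (exists a, a \in J /\ a \notin N); last first.
  left=> a; apply/idP/idP => [aJ|/sub //].
  by apply: contrapT => aM; apply: h; exists a; split=> //; apply/negP.
case: h => y [yJ yN]; right=> z; rewrite inE.
have JM c w : w \in J -> c * w \in J.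
  by move=> wJ; have := JD c w 0 wJ J0; rewrite addr0.
have [a [b yE]] := gen y.
have [[c ac]|[c ac]] := hloc a.
  by case/negP: yN; apply/in_N; exists c, b; rewrite -ac.
have [w yw] := unit_one_add_nil 0 (c * b).
rewrite -[z]mulr1 -yw (_ : z * _ = z * w * f c * y) ?JM //.
rewrite mulr0 addr0 rmorph1 yE.
by transitivity (z * w * (f (a * c) + f (c * b) * x)); [rewrite ac rmorph1|]; ring.
Qed.

Lemma unit_M a : a \notin M -> exists b, a * b = 1.
Proof. by move=> aM; have [/in_M h|//] := hloc a; rewrite h in aM. Qed.

Lemma unit_N y : y \notin N -> exists z, y * z = 1.
Proof.
move=> yN; have [a [b yE]] := gen y.
have [[c ac]|[c ac]] := hloc a.
  by case/negP: yN; apply/in_N; exists c, b; rewrite -ac.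
have [w yw] := unit_one_add_nil 0 (c * b).
exists (f c * w); rewrite -yw mulr0 addr0 rmorph1 yE.
by transitivity ((f (a * c) + f (c * b) * x) * w); [|rewrite ac rmorph1]; ring.
Qed.

Lemma minimal_extension_x : minimal_extension f.
Proof.
split=> //.
  move=> h; have : x \in img f predT by rewrite h.
  by move=> /asboolP[a _ /nx].
move=> C; split; last first.
  case=> CE.
    split.
    - by rewrite CE; apply/asboolP; exists 1; rewrite ?rmorph1.
    - move=> a y z; rewrite !CE => /asboolP[b _ ->] /asboolP[c _ ->].
      by apply/asboolP; exists (a * b + c); rewrite // rmorphD rmorphM.
    - move=> y z; rewrite !CE => /asboolP[b _ ->] /asboolP[c _ ->].
      by apply/asboolP; exists (b * c); rewrite // rmorphM.
  by split=> [|a y z _ _|y z _ _]; rewrite CE.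
case=> C1 CD CM.
have C0 : 0 \in C by have := CD (-1) 1 1 C1 C1; rewrite rmorphN1 mulN1r addNr.
have Cf a : f a \in C by have := CD a 1 0 C1 C0; rewrite mulr1 addr0.
have [Cx|Cx] := pselect (x \in C).
  by right=> y; have [a [b ->]] := gen y; rewrite inE addrC; apply: CD.
left=> y; apply/idP/idP => [Cy|/asboolP[a _ ->]]; last exact: Cf.
have [a [b yE]] := gen y.
have [bM|bM] := boolP (b \in M).
  by apply/asboolP; exists a; rewrite // yE M_x ?addr0.
case: Cx; have [c bc] := unit_M bM.
have -> : x = f c * y + f (- (c * a)).
  rewrite yE; transitivity (f (b * c) * x); first by rewrite bc rmorph1 mul1r.
  by ring.
exact: CD.
Qed.

Lemma special_minimal_ramified_intro : special_minimal_ramified f.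
Proof.
pose mix := GRing.isSubmodClosed.Build B B^o N (GRing.submod_closed_semi submod_N).
pose N' : submodClosed B^o := HB.pack N mix.
have MBN : {subset conductor_image f <= N}.
  by move=> y /conductor_imageP[b ->]; apply/in_N; exists b, 0; rewrite rmorph0 mul0r addr0.
have NN y z : y \in N -> z \in N -> exists b, y * z = f (t * b).
  move=> /in_N[a [b ->]] /in_N[c [d ->]]; exists (b * d * u).
  transitivity (f (t * t) * f (a * c) + f (a * d + b * c) * (f t * x) + f (b * d) * (x * x)); first by ring.
  by rewrite tt tx xx; ring.
have cM : forall y, y \in conductor f -> f y \in conductor_image f.
  by move=> y yc; apply/asboolP; exists y.
have cN : forall y, y \in conductor f -> f y \in N' by move=> y /cM /MBN.
split.
- split; [exact: minimal_extension_x| | |].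
  + exists 2, (fun i => if i == 0 :> nat then 1 else x) => y; have [a [b ->]] := gen y.
    exists (fun i => if i == 0 :> nat then a else b).
    by rewrite !big_ord_recl big_ord0 /= mulr1 addr0.
  + have [iM M1 mM] := maximal_M.
    have E : conductor f =i M by move=> a; apply/idP/idP => /conductorP.
    split; first exact: conductor_submod.
      by rewrite E.
    move=> J iJ sub; have [|JM|JT] := mM J iJ; first by move=> a; rewrite -E; apply: sub.
      by left=> a; rewrite JM E.
    by right.
  + exists N'; split.
    * exact: maximal_N.
    * move=> y /asboolP[n [a [b [ab ->]]]].
      apply: (big_ind (fun y => y \in conductor_image f)).
      - by apply/conductor_imageP; exists 0; rewrite mulr0 rmorph0.
      - move=> _ _ /conductor_imageP[b1 ->] /conductor_imageP[b2 ->].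
        by apply/conductor_imageP; exists (b1 + b2); rewrite mulrDr rmorphD.
      - by move=> i _; apply/conductor_imageP; apply: NN; case: (ab i).
    * split=> // E; have : x \in conductor_image f.
        by rewrite -E; apply/in_N; exists 0, 1; rewrite mulr0 rmorph0 rmorph1 add0r mul1r.
      by move=> /conductor_imageP[b /nx].
    * exists (fun i => if i == 0 :> nat then ringquot_pi _ 1 else ringquot_pi _ x).
      pose g (a b : A) : ringquot (conductor_image f) := ringquot_pi _ (f a + f b * x).
      have gE (a : {ffun 'I_2 -> ringquot (conductor f)}) a0 a1 :
          a ord0 = ringquot_pi _ a0 -> a (lift ord0 ord0) = ringquot_pi _ a1 ->
          \sum_(i < 2) ringquot_map f (conductor f) (conductor_image f) (a i) *
          (if i == 0 :> nat then ringquot_pi _ 1 else ringquot_pi _ x) = g a0 a1.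
        move=> E0 E1; rewrite !big_ord_recl big_ord0 /= addr0 E0 E1.
        by rewrite !ringquot_mapE // !ringquot_piM ringquot_piD mulr1.
      apply: inj_surj_bij => [a b|].
        have : exists a0, a ord0 = ringquot_pi _ a0 by elim/ringquot_ind: (a ord0) => y; exists y.
        have : exists a0, a (lift ord0 ord0) = ringquot_pi _ a0 by elim/ringquot_ind: (a _) => y; exists y.
        have : exists a0, b ord0 = ringquot_pi _ a0 by elim/ringquot_ind: (b ord0) => y; exists y.
        have : exists a0, b (lift ord0 ord0) = ringquot_pi _ a0 by elim/ringquot_ind: (b _) => y; exists y.
        move=> [b1 b1E] [b0 b0E] [a1 a1E] [a0 a0E].
        rewrite (gE _ _ _ a0E a1E) (gE _ _ _ b0E b1E) => /ringquot_eq /conductor_imageP [c cE].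
        have h1 : a1 - b1 \in M.
          apply: (@coef_M _ (t * c - a0 + b0)).
          transitivity (f (t * c) - f a0 + f b0); [rewrite -cE|]; ring.
        have h0 : a0 - b0 \in M.
          apply/in_M; exists c; apply: fI; rewrite -cE.
          rewrite (_ : _ - (f b0 + _) = f (a0 - b0) + f (a1 - b1) * x); last by ring.
          by rewrite M_x ?addr0.
        apply/ffunP => i; case: (unliftP ord0 i) => [j|] ->.
          by rewrite (ord1 j) a1E b1E; apply/ringquot_eq/conductorP.
        by rewrite a0E b0E; apply/ringquot_eq/conductorP.
      elim/ringquot_ind => y; have [a [b yE]] := gen y.
      exists [ffun i : 'I_2 => if i == 0 :> nat then ringquot_pi _ a else ringquot_pi _ b].
      by rewrite (gE _ a b) ?ffunE // /g yE.
    * apply: inj_surj_bij.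
        elim/ringquot_ind => a; elim/ringquot_ind => b; rewrite !ringquot_mapE //.
        move=> /ringquot_eq h; apply/ringquot_eq/conductorP; apply/negPn/negP => /unit_M [c abc].
        case/negP: one_notin_N; rewrite -(rmorph1 f) -abc rmorphM mulrC rmorphB.
        exact: N_mul.
      elim/ringquot_ind => y; have [a [b yE]] := gen y.
      exists (ringquot_pi _ a); rewrite ringquot_mapE //; apply/ringquot_eq.
      apply/in_N; exists 0, (- b); rewrite yE; ring.
- exists M, N; split.
  + by apply: quasi_local_unique; [exact: maximal_M|exact: unit_M].
  + by apply: quasi_local_unique; [exact: maximal_N|exact: unit_N].
  + move=> a; apply/idP/idP => [/asboolP[n [b [c [bc ->]]]]|/eqP ->].
      rewrite inE; apply/eqP; apply: big1 => i _; have [/in_M[b' ->] /in_M[c' ->]] := bc i.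
      by rewrite mulrACA tt mul0r.
    apply/asboolP; exists 0%N, (fun=> 0), (fun=> 0); split; first by case.
    by rewrite big_ord0.
  + move=> a; apply/idP/idP => [/asboolP[n [b [c [bc ->]]]]|/eqP ->].
      rewrite inE; apply/eqP; apply: big1 => i _; have [/asboolP[b' /in_M[b0 ->] ->] /in_N[c0 [c1 ->]]] := bc i.
      transitivity (f (t * t) * f (b0 * c0) + f (b0 * c1) * (f t * x)); first by ring.
      by rewrite tt tx rmorph0 mul0r mulr0 addr0.
    apply/asboolP; exists 0%N, (fun=> 0), (fun=> 0); split; first by case.
    by rewrite big_ord0.
  + move=> y; apply/idP/idP => [/asboolP[n [b [c [bc ->]]]]|/asboolP[a /in_M[c ->] ->]].
      apply: (big_ind (fun y => y \in img f M)).
      * by apply/asboolP; exists 0; rewrite ?rmorph0 //; apply/in_M; exists 0; rewrite mulr0.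
      * move=> _ _ /asboolP[b1 /in_M[c1 ->] ->] /asboolP[b2 /in_M[c2 ->] ->].
        by apply/asboolP; exists (t * (c1 + c2)); [apply/in_M; exists (c1 + c2)|rewrite mulrDr rmorphD].
      * move=> i _; have [bi ci] := bc i; have [w ->] := NN _ _ bi ci.
        by apply/asboolP; exists (t * w) => //; apply/in_M; exists w.
    apply/asboolP; exists 1%N, (fun=> f (c * v) * x), (fun=> x); split.
      move=> i; split; apply/in_N; first by exists 0, (c * v); rewrite mulr0 rmorph0 add0r.
      by exists 0, 1; rewrite mulr0 rmorph0 rmorph1 add0r mul1r.
    rewrite big_ord_recl big_ord0 addr0 -mulrA xx -rmorphM.
    by congr (f _); transitivity (t * c * (u * v)); [rewrite uv mulr1|ring].
Qed.

End Special.

Local Notation frac := Defs.frac.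

(** * Localization as multiplication by an idempotent *)
Section PrimeOfIdem.
Variables (R : comNzRingType) (e : R).
Hypothesis le : local_idem e.

Definition idem_prime : R -> bool := fun a => `[< nilpot (e * a) >].

Fact idem_prime_ideal : idealr_closed (idem_prime : {pred R}).
Proof.
have [ee e0 _] := le; split.
- by apply/asboolP; rewrite mulr0; apply: nil0.
- by apply/negP => /asboolP; rewrite mulr1 => /(nil_idem ee).
- move=> a x y /asboolP nx /asboolP ny; apply/asboolP.
  by rewrite mulrDr mulrCA; apply: nilD => //; apply: nilMl.
Qed.
HB.instance Definition _ := isIdealr.Build R idem_prime idem_prime_ideal.

Fact idem_prime_prime : prime_idealr_closed (idem_prime : {pred R}).
Proof.
move=> a b /asboolP /(local_prime le)[] h; apply/orP; [left|right]; exact/asboolP.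
Qed.
HB.instance Definition _ := isPrimeIdealrClosed.Build R idem_prime idem_prime_prime.

Definition idem_prime_idealr : prime_idealr R := idem_prime.

End PrimeOfIdem.

Section LocAt.
Variables (R : comNzRingType) (M : prime_idealr R) (e : R).
Hypotheses (le : local_idem e) (Me : forall a, a \in M <-> nilpot (e * a)).

Let ee : e * e = e. Proof. by case: le. Qed.

Lemma e_notin : e \notin M.
Proof. by apply/negP => /Me; rewrite ee => /(nil_idem ee) e0; case: le => _; rewrite e0. Qed.

Lemma den_unit (u : denominator M) : exists b, den u * b = e.
Proof. by apply: (local_unit le) => /Me; apply/negP; apply: denP. Qed.

Let eden : denominator M := Denominator e_notin.

Lemma frac_eqP (E : lmodType R) (x y : E) (s t : denominator M) :
  frac x s = frac y t <-> e *: (den t *: x) = e *: (den s *: y).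
Proof.
split=> [/frac_eq [u E1]|h]; last by apply/frac_eq; exists eden.
by have [b ub] := den_unit u; rewrite -ub mulrC -!(scalerA b) E1.
Qed.

Section Lam.
Variable A : comAlgType R.

(** As e is a multiple of every denominator, this map is onto, and it identifies
    exactly the elements with the same multiple by e. *)
Definition locmap (x : A) : loc_alg M A := frac x (den1 M).

Lemma locmapP (p : loc_alg M A) : exists x, p = locmap x.
Proof.
elim/loc_ind: p => x s; have [b sb] := den_unit s.
exists (b *: x); apply/frac_eqP => /=; rewrite scale1r !scalerA -mulrA sb ee; by [].
Qed.

Lemma locmap_eq x y : locmap x = locmap y <-> e *: x = e *: y.
Proof. by rewrite /locmap; split=> [/frac_eqP|h]; [|apply/frac_eqP]; rewrite /= !scale1r. Qed.

Lemma locmapM x y : locmap (x * y) = locmap x * locmap y.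
Proof.
by rewrite /locmap frac_mul; apply/frac_eqP => /=; rewrite mulr1.
Qed.

Lemma locmapD x y : locmap (x + y) = locmap x + locmap y.
Proof.
rewrite /locmap [RHS]frac_add; apply/frac_eqP => /=; by rewrite !scale1r mulr1 scale1r.
Qed.

Lemma locmap0 : locmap 0 = 0. Proof. by []. Qed.
Lemma locmapX x n : locmap (x ^+ n) = locmap x ^+ n.
Proof. by elim: n => // n IH; rewrite !exprS locmapM IH. Qed.
Lemma locmap_sum I (r : seq I) (F : I -> A) : locmap (\sum_(i <- r) F i) = \sum_(i <- r) locmap (F i).
Proof. by elim: r => [|i r IH]; rewrite ?big_nil // !big_cons locmapD IH. Qed.

Lemma locmap_nil x : nilpot (locmap x) <-> nilpot (e *: x).
Proof.
split=> -[n xn]; last first.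
  exists n; rewrite -locmapX -locmap0; apply/locmap_eq.
  transitivity (e *: ((e *: x) ^+ n)); last by rewrite [X in _ *: X]xn.
  rewrite exprZn scalerA; case: n xn => [|n] _; first by rewrite expr0 mulr1.
  by rewrite (idemX n ee) ee.
exists n.+1; rewrite exprZn (idemX n ee) exprSr.
have : locmap (x ^+ n) = locmap 0 by rewrite locmapX xn.
by move=> /locmap_eq; rewrite scaler0 scalerAl => ->; rewrite mul0r.
Qed.

Lemma locmap_in_alg r : loc_in_alg M A (frac (r : R^o) (den1 M)) = locmap r%:A.
Proof. exact: loc_in_algE. Qed.

End Lam.

Definition locmapR (r : R) : loc_alg M R^o := locmap (r : R^o).

Lemma locmapR_eq r s : locmapR r = locmapR s <-> e * r = e * s.
Proof. exact: locmap_eq. Qed.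

Lemma locmapRP (p : loc_alg M R^o) : exists r, p = locmapR r.
Proof. exact: (@locmapP R^o p). Qed.

Lemma locmapRM r s : locmapR (r * s) = locmapR r * locmapR s.
Proof. exact: (@locmapM R^o). Qed.

Lemma locmapRD r s : locmapR (r + s) = locmapR r + locmapR s.
Proof. exact: (@locmapD R^o). Qed.

Lemma locmapR_nil r : nilpot (locmapR r) <-> nilpot (e * r).
Proof. exact: (@locmap_nil R^o). Qed.

Lemma locmapR1 r b : r * b = e -> locmapR r * locmapR b = 1.
Proof. by move=> rb; rewrite -locmapRM rb; apply/locmapR_eq; rewrite ee mulr1. Qed.

Lemma locmapR_0 r : locmapR r = 0 <-> e * r = 0.
Proof. by rewrite -(mulr0 e); apply: (locmapR_eq r 0). Qed.

Lemma locmapR_field : is_field (loc_alg M R^o) <-> forall r, nilpot r -> e * r = 0.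
Proof.
have e0 : e <> 0 by case: le.
split=> [[_ inv] r nr|H].
  apply/eqP; apply: contrapT => /negP /eqP er.
  have r0 : locmapR r != 0 by apply/eqP => /locmapR_0.
  have [q rq] := inv _ r0; have [s qs] := locmapRP q.
  move: rq; rewrite qs -locmapRM => /(locmapR_eq (r * s) 1); rewrite mulr1 => ers.
  by apply: e0; apply: (nil_idem ee); rewrite -ers; apply: nilMl; apply: nilMr.
split.
  by apply/eqP => /(locmapR_0 1); rewrite mulr1.
move=> p; have [r ->] := locmapRP p => r0.
have [nr|[b rb]] : nilpot (e * r) \/ exists b, r * b = e by case: le.
  by have := H _ nr; rewrite mulrA ee => /locmapR_0 r00; rewrite r00 eqxx in r0.
by exists (locmapR b); apply: locmapR1.
Qed.

Lemma SigmaMaxP (fin : finite_set [set I : set R | ideal_set I]) :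
  SigmaMax M <-> infinite_set (principal e).
Proof.
split=> [[_ inf _] fine|inf].
  apply: inf; apply: (sub_finite_set _ (finite_image locmapR fine)) => p _.
  have [r ->] := locmapRP p; exists (e * r); first by exists r.
  by apply/locmapR_eq; rewrite mulrA ee.
split.
- split; first by split=> [|a x y xM yM]; [exact: rpred0|apply: rpredD => //; apply: idealMr].
    by rewrite idealr1.
  move=> J [J0 JD] sub; have [h|h] := pselect (exists a, a \in J /\ a \notin M); last first.
    left=> a; apply/idP/idP => [aJ|/sub //].
    by apply: contrapT => aM; apply: h; exists a; split=> //; apply/negP.
  case: h => a [aJ aM]; right=> z; rewrite inE.
  have [b ab] : exists b, a * b = e by apply: (local_unit le) => /Me; apply/negP.
  have JM c w : w \in J -> c * w \in J.
    by move=> wJ; have := JD c w 0 wJ J0; rewrite addr0.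
  have e1 : 1 - e \in J by apply/sub/Me; rewrite mulrBr mulr1 ee subrr; apply: nil0.
  have := JD (z * b) a (z * (1 - e)) aJ (JM _ _ e1).
  by congr (_ \in J); rewrite [_ *: _]mulrAC -mulrA ab; ring.
- move=> finl; apply: inf.
  apply: (finite_by_data (rel := fun x p => p = locmapR x) finl) => [x _|]; first by exists (locmapR x).
  move=> _ _ p [x ->] [y ->] -> /locmapR_eq; by rewrite !mulrA ee.
- apply: (finite_by_data (rel := fun (J : loc_alg M R^o -> bool) I => I = [set r | J (locmapR r)]) fin).
    move=> J [J0 JD]; exists [set r | J (locmapR r)] => //; split=> /=.
    + exact: J0.
    + move=> x y Jx Jy; rewrite locmapRD.
      by have := JD 1 _ _ Jx Jy; rewrite scale1r.
    + move=> a x Jx; rewrite locmapRM.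
      by have := JD (locmapR a) _ _ Jx J0; rewrite addr0.
  move=> J J' I _ _ -> E; apply/funext => p; have [r ->] := locmapRP p.
  by apply/idP/idP => h; [have : [set r | J (locmapR r)] r by []|have : [set r | J' (locmapR r)] r by []]; rewrite ?E // -E.
Qed.

Lemma frac_0 (E : lmodType R) (q : E) (s : denominator M) : frac q s = 0 <-> e *: q = 0.
Proof.
split=> [/(@frac_eqP E q 0 s (den1 M))|h]; rewrite /= ?scaler0 ?scale1r //.
by apply/(@frac_eqP E q 0 s (den1 M)); rewrite /= !scaler0 scale1r.
Qed.

Lemma Supp_base (A : comAlgType R) :
  Supp (mod_base A) M <-> exists x : A, forall r, e *: x <> r%:A.
Proof.
have H x : e *: (modquot_pi (@base_ring R A) x) = 0 <-> exists r, e *: x = r%:A.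
  rewrite -[e *: _]/(modquot_scale _ _) modquot_scaleE.
  have -> : (0 : modquot (@base_ring R A)) = modquot_pi (@base_ring R A) 0 by rewrite /modquot_pi raddf0.
  split=> [/eqP|[r h]]; first by rewrite modquot_eq subr0 => /asboolP.
  by apply/eqP; rewrite modquot_eq subr0; apply/asboolP; exists r.
split=> [[p]|[x hx]].
  elim/loc_ind: p => q s; elim/modquot_ind: q => x xs.
  exists x => r er; case/eqP: xs; apply/frac_0/H; by exists r.
exists (frac (modquot_pi (@base_ring R A) x) (den1 M)); apply/eqP => /frac_0 /H [r].
exact: hx.
Qed.

End LocAt.

(** Some primitive idempotent is outside M, because 1 is a sum of primitive
    idempotents. *)
Lemma loc_idem_exists (R : comNzRingType) (fin : finite_set [set I : set R | ideal_set I])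
    (M : prime_idealr R) :
  exists2 e : R, local_idem e & forall a, a \in M <-> nilpot (e * a).
Proof.
have [e [pe eM]] : exists e, primitive e /\ e \notin M.
  apply: contrapT => nE.
  have : (1 : R) \in M.
    have id1 : idem (1 : R) by rewrite /idem mulr1.
    apply: (@idem_ind _ (finite_idem fin) (fun g => g \in M)) id1; first exact: rpred0.
      by move=> *; apply: rpredD.
    by move=> g pg; apply: contrapT => gM; apply: nE; exists g; split=> //; apply/negP.
  by rewrite idealr1.
have le := primitive_local (fitting_base fin) pe; exists e => // a; split=> [aM|[n]].
  have [//|[b ab]] : nilpot (e * a) \/ exists b, a * b = e by case: le.
  by case/negP: eM; rewrite -ab mulrC; apply: idealMr.
have XM x k : x ^+ k \in M -> x \in M.
  by elim: k => [|k IH]; rewrite ?expr0 ?idealr1 // exprS prime_idealrM => /orP[].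
move=> ean; have : e * a \in M by apply: (XM _ n); rewrite ean; apply: rpred0.
by rewrite prime_idealrM (negPf eM).
Qed.

(** * Seminormalization *)
Section Seminormalization.
Variables (R : comNzRingType) (S : comAlgType R).
Hypothesis fin : finite_set [set I : set R | ideal_set I].
Variable Sigma : subalgClosed S.
Hypothesis snz : is_seminormalization Sigma.

(** R + Nil(S) is seminormal because R modulo nilpotents is von Neumann regular.
    Conversely, a seminormal subalgebra contains n^i as soon as it contains all
    higher powers of n. *)
Lemma seminormalization_nil x : x \in Sigma <-> exists r, nilpot (x - r%:A).
Proof.
have [sn smallest] := snz.
pose D : {pred S} := fun x => `[< exists r, nilpot (x - r%:A) >].
have Dalg : GRing.subalg_closed D.
  split; first by apply/asboolP; exists 1; rewrite scale1r subrr; apply: nil0.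
    move=> a y z /asboolP[r yr] /asboolP[s zs]; apply/asboolP; exists (a * r + s).
    rewrite (_ : _ - _ = a%:A * (y - r%:A) + (z - s%:A)); first by apply: nilD => //; apply: nilMl.
    by rewrite mulr_algl scalerBr scalerDl scalerA opprD addrACA.
  move=> y z /asboolP[r yr] /asboolP[s zs]; apply/asboolP; exists (r * s).
  rewrite (_ : _ - _ = z * (y - r%:A) + r%:A * (z - s%:A)); first by apply: nilD; apply: nilMl.
  by rewrite -scalerA -[s *: 1]mul1r scalerAl; ring.
pose m := GRing.isSubalgClosed.Build R S D (GRing.subalg_closed_semi Dalg).
pose B : subalgClosed S := HB.pack D m.
have snB : seminormal B.
  move=> b /asboolP[r br] /asboolP[s bs].
  have [c [idc nc]] := fitting_base fin r; apply/asboolP; exists (s * c).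
  (* off the support of r the element b is nilpotent; on it b = b^3 / r *)
  set f := in_alg S; rewrite -[r%:A]/(f r) in br; rewrite -[s%:A]/(f s) in bs.
  rewrite -[_%:A]/(f _).
  have n1 : nilpot ((1 - f (r * c)) * b).
    apply: (nilX (k := 2)).
    rewrite (_ : _ ^+ 2 = (1 - f (r * c)) ^+ 2 * (b ^+ 2 - f r) + (1 - f (r * c)) * f ((1 - r * c) * r)); last by ring.
    by apply: nilD; [apply: nilMl|apply: nilMl; apply: nil_morph].
  rewrite (_ : _ - _ = (1 - f (r * c)) * b + f c * (b ^+ 3 - f s) - f c * b * (b ^+ 2 - f r)); last by ring.
  by apply: nilB; [apply: nilD => //|]; apply: nilMl.
split=> [/(smallest B snB) /asboolP //|[r nr]].
rewrite -[x](subrK r%:A) rpredD ?rpredZ ?rpred1 //.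
move: (x - _) nr => {x} n [k nk].
suff H j : forall i, (k <= i + j)%N -> (0 < i)%N -> n ^+ i \in Sigma.
  by rewrite -[n]expr1; apply: (H k); rewrite // leq_addl.
elim: j => [|j IH] i; first by rewrite addn0 => ki _; rewrite -(subnK ki) exprD nk mulr0 rpred0.
rewrite addnS -addSn => ki i0; apply: sn; rewrite -exprM; apply: IH; rewrite ?muln_gt0 ?i0 //.
  by apply: leq_trans ki _; rewrite leq_add2r muln2 -addnn -addn1 leq_add2l.
by apply: leq_trans ki _; rewrite leq_add2r -addn1 mulnS leq_add2l muln2 double_gt0.
Qed.

Variables (M : prime_idealr R) (e : R).
Hypotheses (le : local_idem e) (Me : forall a, a \in M <-> nilpot (e * a)).
Hypothesis inj : injective (in_alg S).

Local Notation f := (in_alg S).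

Lemma val_alg (r : R) : subalg_val (r%:A : subalg Sigma) = f r.
Proof. by []. Qed.

Lemma Supp_Sigma : Supp (mod_base (subalg Sigma)) M <->
  exists2 n, enil f e n & ~ in_base f n.
Proof.
have ee : e * e = e by case: le.
rewrite (Supp_base le Me); split=> [[x xP]|[n [en nn] nb]].
  have [r nr] := (seminormalization_nil _).1 (valP x).
  exists (f e * (val x - f r)).
    by split; [rewrite mulrA -rmorphM ee|apply: nilMl].
  case=> s sE; apply: (xP (s + e * r)); apply: val_inj.
  transitivity (e *: val x) => //; transitivity (f (s + e * r)) => //.
  rewrite -mulr_algl -[_%:A]/(f e); transitivity (f s + f e * f r); last by ring.
  by rewrite -sE; ring.
have nS : n \in Sigma by apply/seminormalization_nil; exists 0; rewrite scale0r subr0.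
exists (Subalg nS) => r /(congr1 val) h; apply: nb; exists r.
rewrite -[LHS]en /= mulr_algl; exact: h.
Qed.

Lemma locmap_val (w w' : subalg Sigma) :
  locmap M w = locmap M w' <-> f e * subalg_val w = f e * subalg_val w'.
Proof.
rewrite (locmap_eq le Me) !mulr_algl; split=> [/(congr1 val)//|h].
exact: val_inj.
Qed.

Lemma mem_Sigma_nil n : nilpot n -> n \in Sigma.
Proof. by move=> nn; apply/seminormalization_nil; exists 0; rewrite scale0r subr0. Qed.

Lemma special_loc t x : uniformizer e t -> t <> 0 -> almost_base f e x ->
  special_elt e t f x -> (forall n, enil f e n -> lin_span f x n) ->
  special_minimal_ramified (loc_in_alg M (subalg Sigma)).
Proof.
move=> [et nt tP] t0 ax [tt tx [u [v [uv xx]]]] sp.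
have ee : e * e = e by case: le.
have [[ex nx] xb _ _] := ax.
have xS : x \in Sigma by apply: mem_Sigma_nil.
pose L r : loc_alg M R^o := locmapR M r.
pose F : {rmorphism loc_alg M R^o -> loc_alg M (subalg Sigma)} := loc_in_alg M (subalg Sigma).
have LE r : F (L r) = locmap M (r%:A : subalg Sigma) by exact: loc_in_algE.
have lP := locmapRP le Me.
apply: (@special_minimal_ramified_intro _ _ F _ (L t) (L u) (L v) (locmap M (Subalg xS))).
- move=> p q; have [r ->] := lP p; have [s ->] := lP q.
  rewrite !LE => /locmap_val; rewrite !val_alg -!rmorphM => /inj h.
  exact/(locmapR_eq le Me).
- move=> p; have [r ->] := lP p.
  have [nr|[b rb]] : nilpot (e * r) \/ exists b, r * b = e by case: le.
    left; have [b eb] := tP r nr; exists (L b).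
    rewrite /L -(locmapRM le Me); apply/(locmapR_eq le Me).
    by rewrite -eb mulrA ee.
  by right; exists (L b); apply: (locmapR1 le Me).
- by move/(locmapR_0 le Me); rewrite et.
- by rewrite /L -(locmapRM le Me) tt.
- rewrite LE -(locmapM le Me) -(locmap0 M (subalg Sigma)); apply/locmap_val.
  by rewrite /= [X in f e * X](_ : _ = f t * x) // tx.
- by apply: (locmapR1 le Me).
- rewrite -(locmapM le Me) /L -(locmapRM le Me) LE; apply/locmap_val.
  by rewrite val_alg [X in f e * X](_ : _ = x * x) // xx [u * t]mulrC.
- move=> p; have [w ->] := locmapP le Me p.
  have [r nr] := (seminormalization_nil _).1 (valP w).
  have [|a [b ab]] := sp (f e * (subalg_val w - f r)).
    by split; [rewrite mulrA -rmorphM ee|apply: nilMl].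
  exists (L (r + a)), (L b); rewrite !LE -(locmapM le Me) -(locmapD le Me); apply/locmap_val.
  rewrite [in RHS](_ : subalg_val _ = f (r + a) + f b * x) //.
  transitivity (f e * f r + f e * (f e * (subalg_val w - f r))).
    by rewrite mulrA -[f e * f e]rmorphM ee; ring.
  by rewrite ab; ring.
- move=> p; have [r ->] := lP p; rewrite LE => /locmap_val.
  rewrite val_alg /= ex => h; apply: xb; exists (e * r).
  by rewrite rmorphM.
Qed.

End Seminormalization.

Section SpecialOut.
Variables (R : comNzRingType) (S : comAlgType R).
Hypothesis fin : finite_set [set I : set R | ideal_set I].
Variable Sigma : subalgClosed S.
Hypothesis snz : is_seminormalization Sigma.
Variables (M : prime_idealr R) (e : R).
Hypotheses (le : local_idem e) (Me : forall a, a \in M <-> nilpot (e * a)).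
Hypothesis inj : injective (in_alg S).
Local Notation f := (in_alg S).
Hypothesis spec : special_minimal_ramified (loc_in_alg M (subalg Sigma)).

Let ee : e * e = e. Proof. by case: le. Qed.

(** The image of T in the localization is an intermediate ring of a minimal
    extension. *)
Lemma special_min T : subal f T -> (forall n, T n -> enil f e n -> in_base f n) \/
     (forall n, enil f e n -> T n).
Proof.
move=> sT; have [[minx _ _ _] _] := spec; have [_ _ min] := minx.
pose C : loc_alg M (subalg Sigma) -> bool :=
  fun p => `[< exists w : subalg Sigma, T (subalg_val w) /\ p = locmap M w >].
have iC : intermediate (loc_in_alg M (subalg Sigma)) C.
  have lP := locmapRP le Me.
  split.
  - by apply/asboolP; exists 1; split; [apply: (subal1 sT)|].
  - move=> p _ _ /asboolP[w [Tw ->]] /asboolP[w' [Tw' ->]]; apply/asboolP.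
    have [r ->] := lP p; exists (r%:A * w + w'); split.
      by apply: (subalD sT) => //; apply: (subalM sT) => //; apply: (subal_base sT).
    by rewrite (locmapD le Me) (locmapM le Me) -locmap_in_alg.
  - move=> _ _ /asboolP[w [Tw ->]] /asboolP[w' [Tw' ->]]; apply/asboolP.
    by exists (w * w'); split; [apply: (subalM sT)|rewrite (locmapM le Me)].
have lv := locmap_val le Me.
have [CE|CE] := (min C).1 iC; [left=> n Tn [en nn]|right=> n [en nn]].
  have nS := mem_Sigma_nil fin snz nn.
  have : locmap M (Subalg nS) \in C by apply/asboolP; exists (Subalg nS).
  rewrite CE => /asboolP[p _]; have [r ->] := locmapRP le Me p.
  rewrite [X in _ = X -> _]loc_in_algE => /lv /= h; exists (e * r).
  by rewrite -[LHS]en rmorphM; apply: h.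
have nS := mem_Sigma_nil fin snz nn.
have : locmap M (Subalg nS) \in C by rewrite CE.
move=> /asboolP[w [Tw /lv /= h]].
by rewrite -en [X in T X]h; apply: (subalM sT) => //; apply: (subal_base sT).
Qed.

(** The maximal ideals of the definition have to be the sets of nilpotent elements:
    a maximal ideal contains all nilpotents, and here N^4 = M^2 = 0. *)
Lemma special_products :
  (forall r n, e * r = r -> nilpot r -> enil f e n -> f r * n = 0) /\
  (forall r, e * r = r -> nilpot r -> exists N (a b : 'I_N -> S),
     (forall i, enil f e (a i) /\ enil f e (b i)) /\ f r = \sum_(i < N) a i * b i).
Proof.
have [_ [M0 [N0 [qM qN MM MN NN]]]] := spec.
have lv := locmap_val (Sigma := Sigma) le Me.
have mM : maximal_ideal M0 by apply/qM.
have mN : maximal_ideal N0 by apply/qN.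
have e0 : e <> 0 by case: le.
have img r : e * r = r -> nilpot r -> locmap M (r%:A : subalg Sigma) \in img (loc_in_alg M (subalg Sigma)) M0.
  move=> er nr; apply/asboolP; exists (locmapR M r); last by rewrite [RHS]loc_in_algE.
  by apply: (maximal_nil mM); apply/(locmapR_nil le Me); rewrite er.
split=> [r n er nr [en nn]|r er nr].
  have nS := mem_Sigma_nil fin snz nn.
  have nN : locmap M (Subalg nS) \in N0.
    by apply: (maximal_nil mN); apply/(locmap_nil le Me); rewrite -mulr_algl; apply: nilMl;
      case: nn => k nk; exists k; apply: val_inj; rewrite rmorphXn.
  have : locmap M (r%:A * Subalg nS : subalg Sigma) \in sum_products (Defs.img (loc_in_alg M (subalg Sigma)) M0) N0.
    apply/asboolP; exists 1%N, (fun=> locmap M (r%:A : subalg Sigma)), (fun=> locmap M (Subalg nS)).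
    by split=> [_|]; [split=> //; apply: img|rewrite big_ord_recl big_ord0 addr0 (locmapM le Me)].
  rewrite MN inE -(locmap0 M (subalg Sigma)) => /eqP /lv; rewrite mulr0.
  rewrite -[subalg_val _]/(f r * n) => h.
  by rewrite -er rmorphM -mulrA.
have := img r er nr; rewrite -NN => /asboolP[N [a [b [ab rE]]]].
have lift (y : loc_alg M (subalg Sigma)) : y \in N0 -> exists w : subalg Sigma, y = locmap M w /\ enil f e (f e * subalg_val w).
  move=> yN; have [w wE] := locmapP le Me y; exists w; split=> //.
  split; first by rewrite mulrA -[f e * f e]rmorphM ee.
  have : nilpot y.
    have : y * y \in sum_products N0 N0.
      apply/asboolP; exists 1%N, (fun=> y), (fun=> y); split=> //.
      by rewrite big_ord_recl big_ord0 addr0.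
    rewrite NN => /asboolP[m mM0 yyE].
    have m2 : m * m = 0.
      have : m * m \in sum_products M0 M0.
        apply/asboolP; exists 1%N, (fun=> m), (fun=> m); split=> //.
        by rewrite big_ord_recl big_ord0 addr0.
      by rewrite MM inE => /eqP.
    exists 4%N; rewrite (_ : y ^+ 4 = (y * y) * (y * y)); last by ring.
    by rewrite yyE -rmorphM m2 rmorph0.
  rewrite wE => /(locmap_nil le Me)[k kE]; exists k.
  by have := congr1 val kE; rewrite rmorphXn /= => <-; rewrite mulr_algl.
have [wa waP] := choice (fun i => lift _ (ab i).1).
have [wb wbP] := choice (fun i => lift _ (ab i).2).
exists N, (fun i => f e * subalg_val (wa i)), (fun i => f e * subalg_val (wb i)); split.
  by move=> i; split; [case: (waP i)|case: (wbP i)].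
have : locmap M (r%:A : subalg Sigma) = locmap M (\sum_(i < N) wa i * wb i).
  rewrite rE (locmap_sum le Me); apply: eq_bigr => i _.
  by rewrite (locmapM le Me) -(waP i).1 -(wbP i).1.
move=> /lv; rewrite -[subalg_val r%:A]/(f r) -rmorphM er => ->.
have -> : subalg_val (\sum_(i < N) wa i * wb i) = \sum_(i < N) subalg_val (wa i) * subalg_val (wb i).
  by rewrite -[subalg_val _]/(val _) rmorph_sum.
rewrite mulr_sumr; apply: eq_bigr => i _.
by rewrite mulrACA -rmorphM ee.
Qed.

End SpecialOut.

(** * The two implications *)
Section Swap.
Variables (R S1 S2 : comNzRingType) (f1 : {rmorphism R -> S1}) (f2 : {rmorphism R -> S2}).

Definition swap_set (T U : Type) (C : set (T * U)) : set (U * T) := [set z | C (z.2, z.1)].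

Lemma swap_setK T U : cancel (@swap_set T U) (@swap_set U T).
Proof. by move=> C; apply/seteqP; split=> -[x y]. Qed.

Lemma subal_swap C : subal (diag f1 f2) C -> subal (diag f2 f1) (swap_set C).
Proof.
move=> sC; split.
- by move=> r; apply: (subal_base sC).
- by move=> [x y] [x' y'] h h'; apply: (mem_pairB sC).
- by move=> [x y] [x' y'] h h'; apply: (mem_pairM sC).
Qed.

Lemma finite_subal_swap : finite_set [set C | subal (diag f2 f1) C] ->
  finite_set [set C | subal (diag f1 f2) C].
Proof.
move=> fin; apply: (sub_finite_set _ (finite_image (@swap_set S2 S1) fin)) => C sC.
by exists (swap_set C); [apply: subal_swap|rewrite swap_setK].
Qed.

Lemma finite_parts_swap e : finite_parts f2 f1 e -> finite_parts f1 f2 e.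
Proof.
move=> fin; apply: (sub_finite_set _ (finite_image (@swap_set S2 S1) fin)).
move=> _ [C sC <-]; exists (epart f2 f1 e (swap_set C)).
  by exists (swap_set C) => //; apply: subal_swap.
apply/seteqP; split=> -[x y] [Cxy] [e1 e2]; split=> //=; congr pair => //.
Qed.

Lemma finite_ideal_sets : injective f1 -> injective f2 -> finite_set [set C | subal (diag f1 f2) C] ->
  finite_set [set I : set R | ideal_set I].
Proof.
move=> f1I f2I fin.
apply: (finite_by_data (rel := fun I C => C = [set z | exists a i, I i /\ z = (f1 a, f2 (a + i))]) fin).
  move=> I [I0 ID IM]; exists [set z | exists a i, I i /\ z = (f1 a, f2 (a + i))] => //; split.
  - by move=> r; exists r, 0; rewrite addr0.
  - move=> _ _ [a [i [Ii ->]]] [b [j [Ij ->]]]; exists (a - b), (i - j).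
    split; first by rewrite -[- j]mulN1r; apply: ID => //; apply: IM.
    by congr pair; rewrite /=; ring.
  - move=> _ _ [a [i [Ii ->]]] [b [j [Ij ->]]]; exists (a * b), (a * j + (b + j) * i).
    split; first by apply: ID; apply: IM.
    by congr pair; rewrite /=; ring.
suff H I J i : ideal_set I -> ideal_set J -> [set z | exists a i, I i /\ z = (f1 a, f2 (a + i))] =
    [set z | exists a i, J i /\ z = (f1 a, f2 (a + i))] -> I i -> J i.
  by move=> I J _ iI iJ -> E; apply/seteqP; split=> i; apply: H.
move=> iI [J0 JD JM] E Ii.
have : [set z | exists a i, I i /\ z = (f1 a, f2 (a + i))] (f1 0, f2 i).
  by exists 0, i; rewrite add0r.
rewrite E => -[a [j [Jj [/f1I <- /f2I]]]].
by rewrite add0r => ->.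
Qed.

End Swap.

Section OneSide.
Variables (R : comNzRingType) (S1 S2 : comAlgType R).
Local Notation f1 := (in_alg S1).
Local Notation f2 := (in_alg S2).
Hypotheses (inj1 : injective f1) (inj2 : injective f2).
Hypothesis fin : finite_set [set I : set R | ideal_set I].
Hypotheses (FIP1 : finite_set [set C | subal f1 C]) (FIP2 : finite_set [set C | subal f2 C]).
Variables (Sigma1 : subalgClosed S1) (Sigma2 : subalgClosed S2).
Hypotheses (snz1 : is_seminormalization Sigma1) (snz2 : is_seminormalization Sigma2).

Section Necessity.
Hypothesis FIPd : finite_set [set C | subal (diag f1 f2) C].
Variable M : prime_idealr R.

Lemma almost_base_Supp (S : comAlgType R) (Sigma : subalgClosed S) e :
  is_seminormalization Sigma -> local_idem e -> (forall a, a \in M <-> nilpot (e * a)) ->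
  infinite_residue e -> Supp (mod_base (subalg Sigma)) M ->
  exists x, almost_base (in_alg S) e x.
Proof.
move=> snz le Me inf /(Supp_Sigma fin snz le Me)[n en nb].
have [t ut] := infinite_residue_principal fin le inf.
exact: (almost_exists ut en nb).
Qed.

Lemma SigmaMax_infinite_residue e : local_idem e -> (forall a, a \in M <-> nilpot (e * a)) ->
  SigmaMax M -> infinite_residue e.
Proof. by move=> le Me /(SigmaMaxP le Me fin) /(infinite_residue_of_infinite fin le). Qed.

Lemma Supp_disjoint :
  ~ [/\ Supp (mod_base (subalg Sigma1)) M, Supp (mod_base (subalg Sigma2)) M & SigmaMax M].
Proof.
case=> s1 s2 sM; have [e le Me] := loc_idem_exists fin M.
have inf := SigmaMax_infinite_residue le Me sM.
have [x ax] := almost_base_Supp snz1 le Me inf s1.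
have [y ay] := almost_base_Supp snz2 le Me inf s2.
exact: (not_both_almost_base inj1 inj2 le inf FIPd ax ay).
Qed.

Lemma special_or_field :
  Supp (mod_base (subalg Sigma1)) M -> SigmaMax M ->
  special_minimal_ramified (loc_in_alg M (subalg Sigma1)) \/ is_field (loc_alg M R^o).
Proof.
move=> s1 sM; have [e le Me] := loc_idem_exists fin M.
have inf := SigmaMax_infinite_residue le Me sM.
have [t ut] := infinite_residue_principal fin le inf.
have [x ax] := almost_base_Supp snz1 le Me inf s1.
have [t0|t0] := pselect (t = 0).
  right; apply/(locmapR_field le Me) => r nr; have [_ _ tP] := ut.
  by have [b ->] := tP r (nilMl e nr); rewrite t0 mul0r.
left; have sx := almost_special inj1 inj2 le inf FIPd ut t0 ax.
apply: (special_loc fin snz1 le Me inj1 ut t0 ax sx) => n.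
exact: (enil_span inj1 le inf FIP1 ut t0 ax sx).
Qed.

End Necessity.

Section Sufficiency.
Variables (M : prime_idealr R) (e : R).
Hypotheses (le : local_idem e) (Me : forall a, a \in M <-> nilpot (e * a)).

Lemma finite_parts_Supp : infinite_residue e ->
  ~ Supp (mod_base (subalg Sigma2)) M ->
  (Supp (mod_base (subalg Sigma1)) M ->
   special_minimal_ramified (loc_in_alg M (subalg Sigma1)) \/ is_field (loc_alg M R^o)) ->
  finite_parts f1 f2 e.
Proof.
move=> inf ns2 h1.
have base (S : comAlgType R) (Sigma : subalgClosed S) : is_seminormalization Sigma ->
    ~ Supp (mod_base (subalg Sigma)) M -> forall n, enil (in_alg S) e n -> in_base (in_alg S) n.
  move=> snz ns n en; apply: contrapT => nb; apply: ns.
  by apply/(Supp_Sigma fin snz le Me); exists n.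
have base2 := base _ _ snz2 ns2.
apply: (finite_parts_local fin FIP1 FIP2 inj1 inj2 le base2).
  exact: (infinite_residue_principal fin le inf).
have [s1|ns1] := pselect (Supp (mod_base (subalg Sigma1)) M); last first.
  by apply: dichotomy_base; apply: base ns1.
have [spec|fld] := h1 s1.
  have [MN NN] := special_products fin snz1 le Me spec.
  apply: (dichotomy_special fin FIP2 inj2 le base2) => //.
  exact: (special_min fin snz1 le Me spec).
apply: (dichotomy_field fin FIP2 inj2 le base2).
exact/(locmapR_field le Me).
Qed.

End Sufficiency.
End OneSide.

Theorem theorem2p17 (R : comNzRingType) (S1 S2 : comAlgType R)
    (inj1 : injective (in_alg S1)) (inj2 : injective (in_alg S2))
    (FIP1 : FIP (in_alg S1)) (FIP2 : FIP (in_alg S2))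
    (Sigma1 : subalgClosed S1) (Sigma2 : subalgClosed S2)
    (snz1 : is_seminormalization Sigma1) (snz2 : is_seminormalization Sigma2) :
  FIP (in_alg (S1 * S2)%type) <->
  [/\ finitely_many_ideals R,
      forall M : prime_idealr R,
        ~ [/\ Supp (mod_base (subalg Sigma1)) M,
              Supp (mod_base (subalg Sigma2)) M & SigmaMax M]
    & (forall M : prime_idealr R,
         Supp (mod_base (subalg Sigma1)) M -> SigmaMax M ->
         special_minimal_ramified (loc_in_alg M (subalg Sigma1)) \/
         is_field (loc_alg M R^o)) /\
      (forall M : prime_idealr R,
         Supp (mod_base (subalg Sigma2)) M -> SigmaMax M ->
         special_minimal_ramified (loc_in_alg M (subalg Sigma2)) \/
         is_field (loc_alg M R^o))].
Proof.
move/FIP_subal: FIP1 => {}FIP1; move/FIP_subal: FIP2 => {}FIP2.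
have dE : (in_alg (S1 * S2)%type : R -> _) = diag (in_alg S1) (in_alg S2) by apply: funext.
rewrite FIP_subal dE; split=> [FIPd|[/finitely_many_ideal_sets fin disj [h1 h2]]].
  have fin := finite_ideal_sets inj1 inj2 FIPd; split=> [|M|]; first exact/finitely_many_ideal_sets.
    exact: (Supp_disjoint inj1 inj2 fin snz1 snz2 FIPd).
  split=> M; first exact: (special_or_field inj1 inj2 fin FIP1 snz1 FIPd).
  have FIPd2 := @finite_subal_swap R S2 S1 (in_alg S2) (in_alg S1) FIPd.
  exact: (special_or_field inj2 inj1 fin FIP2 snz2 FIPd2).
apply: (@finite_parts_glue R S1 S2 (in_alg S1) (in_alg S2) fin) => e pe.
have le := primitive_local (fitting_base fin) pe.
have [fine|infe] := pselect (finite_set (principal e)).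
  exact: (finite_parts_finite fin FIP1 FIP2 le fine).
pose M := idem_prime_idealr le.
have Me a : a \in M <-> nilpot (e * a) by split=> /asboolP.
have sM : SigmaMax M by apply/(SigmaMaxP le Me fin).
have inf := infinite_residue_of_infinite fin le infe.
have [s2|ns2] := pselect (Supp (mod_base (subalg Sigma2)) M); last first.
  apply: (finite_parts_Supp inj1 inj2 fin FIP1 FIP2 snz1 snz2 le Me inf ns2) => s1.
  exact: h1.
apply: finite_parts_swap.
have ns1 : ~ Supp (mod_base (subalg Sigma1)) M by move=> s1; apply: (disj M).
apply: (finite_parts_Supp inj2 inj1 fin FIP2 FIP1 snz2 snz1 le Me inf ns1) => _.
exact: h2.
Qed.
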